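(* Let $n\ge2$. For any $N\in\mathbb N$ and any real number $M>0$ there exists a bounded domain $\Omega_{M,N}$ of the hyperbolic space $\mathbb H^n$, with Lipschitz boundary, such that $|\Omega_{M,N}|=1$ and $$\mu_j\le -M$$ for all $j\le N$, where $\mu_j=\mu_j(\Omega_{M,N})$ are the biharmonic Neumann eigenvalues of $\Omega_{M,N}$.
   Context: $\mathbb H^n$ is the standard hyperbolic space of constant sectional curvature $-1$; a domain is a connected open set; $|\Omega|$ is the Riemannian volume of $\Omega$; $\mathbb N$ is the set of positive integers. $H^2(\Omega)$ is the completion of $C^\infty(\Omega)$ (functions with finite norm) with respect to $\left(\int_\Omega(|D^2f|^2+|\nabla f|^2+f^2)dv\right)^{1/2}$, with $D^2$ the Hessian and $dv$ the Riemannian volume element. The biharmonic Neumann eigenvalues $\mu_1\le\mu_2\le\cdots$ (repeated with multiplicity) are the eigenvalues of $\int_\Omega(\langle D^2u,D^2\phi\rangle+\mathrm{Ric}(\nabla u,\nabla\phi))dv=\mu\int_\Omega u\phi\,dv$ for all $\phi\in H^2(\Omega)$, with $u\in H^2(\Omega)$, $\mu\in\mathbb R$, that is $$\mu_j=\min_{\substack{U\subset H^2(\Omega)\\ \dim U=j}}\max_{0\ne u\in U}\frac{\int_\Omega(|D^2u|^2+\mathrm{Ric}(\nabla u,\nabla u))dv}{\int_\Omega u^2dv}.$$ *)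

(* Defs.v *)
From HB Require Import structures.
From mathcomp Require Import all_boot all_order all_algebra.
From mathcomp Require Import all_classical all_reals all_analysis.

Set Implicit Arguments.
Unset Strict Implicit.
Unset Printing Implicit Defensive.

Import Order.TTheory GRing.Theory Num.Theory.
Import numFieldNormedType.Exports.

Local Open Scope classical_set_scope.
Local Open Scope ring_scope.

Definition measure_rV_display : measure_display -> measure_display.
Proof. exact. Qed.

(* The product sigma-algebra on row vectors, as in the library's instance on
   [n.-tuple T]; for T = R it is the Borel sigma-algebra of R^n. *)
Section measurable_rV.
Context {d} {T : measurableType d} (n : nat).

Let coors : 'I_n -> 'rV[T]_n -> T := fun i x => x ord0 i.

Let rV_set0 : g_sigma_preimage coors set0.
Proof. exact: sigma_algebra0. Qed.

Let rV_setC A : g_sigma_preimage coors A -> g_sigma_preimage coors (~` A).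
Proof. exact: sigma_algebraC. Qed.

Let rV_bigcup (F : (set 'rV[T]_n)^nat) :
  (forall i, g_sigma_preimage coors (F i)) ->
  g_sigma_preimage coors (\bigcup_i (F i)).
Proof. exact: sigma_algebra_bigcup. Qed.

HB.instance Definition _ := @isMeasurable.Build (measure_rV_display d)
  'rV[T]_n (g_sigma_preimage coors) rV_set0 rV_setC rV_bigcup.

End measurable_rV.

Section coord_measurability.
Context {d} {T : measurableType d}.

Lemma measurable_coord n (i : 'I_n) :
  measurable_fun setT (fun x : 'rV[T]_n => x ord0 i).
Proof.
move=> _ Y mY; rewrite setTI; apply: sub_sigma_algebra => /=.
rewrite -bigcup_seq/=; exists i => /=; first by rewrite mem_index_enum.
by exists Y => //; rewrite setTI.
Qed.

Lemma measurable_fun_coordP d1 (T1 : measurableType d1) n (f : T1 -> 'rV[T]_n) :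
  (forall i, measurable_fun setT (fun t => f t ord0 i)) ->
  measurable_fun setT f.
Proof.
move=> mf _ A; rewrite setTI => mA.
pose G := image_set_system setT f (@measurable _ T1).
have GE B : G B = measurable (f @^-1` B).
  by rewrite /G /image_set_system /= setTI.
suff : G A by rewrite GE.
move: A mA; apply: smallest_sub.
  exact/sigma_algebra_image/sigma_algebra_measurable.
rewrite -bigcup_seq/= => B [i _] [C mC <-]; rewrite setTI GE.
by rewrite -[X in measurable X]setTI; exact: (mf i measurableT C mC).
Qed.

End coord_measurability.

Section lebesgue_rV.
Context {R : realType}.

Definition cons_rV n (p : measurableTypeR R * 'rV[R]_n) : 'rV[R]_n.+1 :=
  row_mx (p.1%:M : 'rV[R]_1) p.2.

Fixpoint lebesgue_rV n : set 'rV[R]_n -> \bar R :=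
  match n with
  | 0 => @dirac _ 'rV[R]_0 0 R
  | m.+1 => pushforward (product_measure1 lebesgue_measure (@lebesgue_rV m))
              (@cons_rV m)
  end.

Lemma cons_rV0 n (p : measurableTypeR R * 'rV[R]_n) : cons_rV p ord0 ord0 = p.1.
Proof.
rewrite /cons_rV mxE; case: splitP => [j _|j //].
by rewrite mxE [j]ord1 eqxx mulr1n.
Qed.

Lemma cons_rVS n (p : measurableTypeR R * 'rV[R]_n) i :
  cons_rV p ord0 (lift ord0 i) = p.2 ord0 i.
Proof.
rewrite /cons_rV mxE; case: splitP => [j /= |j /=].
  by rewrite [j]ord1.
by rewrite /bump /= => -[ij]; congr (_ _ _); apply: val_inj.
Qed.

Lemma measurable_cons_rV n : measurable_fun setT (@cons_rV n).
Proof.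
apply: measurable_fun_coordP => i; have [j ->|->] := unliftP ord0 i.
  under eq_fun do rewrite cons_rVS.
  exact: (measurableT_comp (measurable_coord j) measurable_snd).
under eq_fun do rewrite cons_rV0.
exact: measurable_fst.
Qed.

Section lebesgue_rV_step.
Variables (n : nat) (m : {sigma_finite_measure set 'rV[R]_n -> \bar R}).

Let step : set 'rV[R]_n.+1 -> \bar R :=
  pushforward (lebesgue_measure \x m)%E (@cons_rV n).

Let mpre A : measurable A -> measurable (@cons_rV n @^-1` A).
Proof.
by move=> mA; rewrite -[X in measurable X]setTI; exact: measurable_cons_rV.
Qed.

Let step0 : step set0 = 0%E.
Proof. by rewrite /step /pushforward preimage_set0 measure0. Qed.

Let step_ge0 A : (0 <= step A)%E.
Proof. by rewrite /step /pushforward; exact: measure_ge0. Qed.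

Let step_sigma_additive : semi_sigma_additive step.
Proof.
move=> F mF tF mUF; rewrite /step /pushforward preimage_bigcup.
apply: measure_semi_sigma_additive.
- by move=> k; exact: mpre.
- apply/trivIsetP => /= i j _ _ ij; rewrite -preimage_setI.
  by move/trivIsetP : tF => /(_ _ _ _ _ ij) ->//; rewrite preimage_set0.
- by rewrite -preimage_bigcup; exact: mpre.
Qed.

HB.instance Definition _ := isMeasure.Build _ _ _ step
  step0 step_ge0 step_sigma_additive.

Let step_sigma_finite : sigma_finite setT step.
Proof.
pose f (v : 'rV[R]_n.+1) : measurableTypeR R * 'rV[R]_n :=
  (v ord0 ord0, \row_i v ord0 (lift ord0 i)).
have mf : measurable_fun setT f.
  apply: measurable_fun_pair; first exact: measurable_coord.
  apply: measurable_fun_coordP => i.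
  under eq_fun do rewrite mxE.
  exact: measurable_coord.
have fK p : f (cons_rV p) = p.
  case: p => a b; rewrite /f cons_rV0; congr pair.
  by apply/rowP => i; rewrite mxE cons_rVS.
(* The library's sigma-finiteness instance of a product measure is shadowed by
   the one for subprobabilities, hence the direct argument. *)
have /sigma_finiteP[G [TG ndG Goo]] := sigma_finiteT (@lebesgue_measure R).
have /sigma_finiteP[H [TH ndH Hoo]] := sigma_finiteT m.
pose F k := G k `*` H k.
have UF : setT = \bigcup_k F k.
  rewrite -setXTT TG TH predeqE => -[x y]; split; last first.
    by move=> [k _ []/= ? ?]; split; exists k.
  move=> [/= [k _ Gkx] [l _ Hly]]; exists (maxn k l) => //; split.
  - by move: x Gkx; exact/subsetPset/ndG/leq_maxl.
  - by move: y Hly; exact/subsetPset/ndH/leq_maxr.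
have mF k : measurable (F k) /\ ((lebesgue_measure \x m)%E (F k) < +oo)%E.
  have [? ?] := Goo k; have [? ?] := Hoo k.
  split; first exact: measurableX.
  by rewrite product_measure1E// lte_mul_pinfty// ge0_fin_numE.
exists (fun k => f @^-1` F k) => [|k].
  by rewrite -preimage_bigcup -UF preimage_setT.
have [mFk Fk] := mF k; split.
  by rewrite -[X in measurable X]setTI; exact: mf.
rewrite /step /pushforward (_ : _ @^-1` _ = F k)//.
by apply/seteqP; split => p /=; rewrite fK.
Qed.

HB.instance Definition _ := Measure_isSigmaFinite.Build _ _ _ step
  step_sigma_finite.

Lemma lebesgue_rV_step :
  {m' : {sigma_finite_measure set 'rV[R]_n.+1 -> \bar R} |
    m' = pushforward (lebesgue_measure \x m)%E (@cons_rV n)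
    :> (set _ -> _)}.
Proof. by exists step. Qed.

End lebesgue_rV_step.

Lemma lebesgue_rV_measure n :
  {m : {sigma_finite_measure set 'rV[R]_n -> \bar R} |
    m = @lebesgue_rV n :> (set _ -> _)}.
Proof.
elim: n => [|n [m mE]]; first by exists (@dirac _ 'rV[R]_0 0 R).
by have [m' m'E] := lebesgue_rV_step m; exists m'; rewrite m'E mE.
Qed.

Section lebesgue_rV_instance.
Variable n : nat.

Let leb0 : @lebesgue_rV n set0 = 0%E.
Proof. by have [m <-] := lebesgue_rV_measure n; exact: measure0. Qed.

Let leb_ge0 A : (0 <= @lebesgue_rV n A)%E.
Proof. by have [m <-] := lebesgue_rV_measure n; exact: measure_ge0. Qed.

Let leb_sigma_additive : semi_sigma_additive (@lebesgue_rV n).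
Proof.
by have [m <-] := lebesgue_rV_measure n; exact: measure_semi_sigma_additive.
Qed.

HB.instance Definition _ := isMeasure.Build _ _ _ (@lebesgue_rV n)
  leb0 leb_ge0 leb_sigma_additive.

Let leb_sigma_finite : sigma_finite setT (@lebesgue_rV n).
Proof. by have [m <-] := lebesgue_rV_measure n; exact: sigma_finiteT. Qed.

HB.instance Definition _ := Measure_isSigmaFinite.Build _ _ _ (@lebesgue_rV n)
  leb_sigma_finite.

End lebesgue_rV_instance.

Lemma measurable_rect n (A : 'I_n -> set R) : (forall i, measurable (A i)) ->
  measurable [set x : 'rV[R]_n | forall i, A i (x ord0 i)].
Proof.
move=> mA; rewrite (_ : mkset _ =
    \big[setI/setT]_(i < n) ((fun x : 'rV[R]_n => x ord0 i) @^-1` A i)).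
  apply: bigsetI_measurable => i _.
  by rewrite -[X in measurable X]setTI; exact: measurable_coord.
rewrite -bigcap_seq; apply/seteqP; split => x /= h i.
  by move=> _; exact: h.
by apply: h => /=; rewrite mem_index_enum.
Qed.

Lemma lebesgue_rV_rect n (A : 'I_n -> set R) : (forall i, measurable (A i)) ->
  lebesgue_rV [set x : 'rV[R]_n | forall i, A i (x ord0 i)] =
  (\prod_(i < n) lebesgue_measure (A i))%E.
Proof.
elim: n A => [|n IH] A mA.
  rewrite big_ord0 /= diracE (_ : _ \in _)// inE /=.
  by case.
rewrite big_ord_recl -(IH (fun i => A (lift ord0 i)))//=.
rewrite /pushforward (_ : _ @^-1` _ = A ord0 `*`
    [set x : 'rV[R]_n | forall i, A (lift ord0 i) (x ord0 i)]); last first.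
  apply/seteqP; split=> p /=.
    move=> h; split; first by rewrite -cons_rV0; exact: h.
    by move=> i; rewrite -cons_rVS; exact: h.
  move=> [h0 hS] i; have [j ->|->] := unliftP ord0 i.
    by rewrite cons_rVS.
  by rewrite cons_rV0.
rewrite product_measure1E//; first exact: mA.
by apply: (@measurable_rect n (fun i : 'I_n => A (lift ord0 i))) => i; exact: mA.
Qed.

End lebesgue_rV.
Arguments lebesgue_rV {R n}.

Section riemann.
Context {R : realType} {n : nat}.
Implicit Types (g : 'rV[R]_n -> 'M[R]_n) (u : 'rV[R]_n -> R) (x : 'rV[R]_n).

Definition partial (i : 'I_n) u : 'rV[R]_n -> R :=
  fun x => 'D_(delta_mx ord0 i) u x.

(* All iterated partial derivatives are differentiable on Omega. Only the
   values of u on the open set Omega matter. *)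
Definition smooth_on (Omega : set 'rV[R]_n) u : Prop :=
  forall (s : seq 'I_n) x, Omega x -> differentiable (foldr partial u s) x.

Definition christoffel g (k i j : 'I_n) x : R :=
  2^-1 * \sum_l invmx (g x) k l *
    (partial i (fun y => g y j l) x + partial j (fun y => g y i l) x
     - partial l (fun y => g y i j) x).

Definition ricci g x : 'M[R]_n := \matrix_(i, j)
  (\sum_k (partial k (christoffel g k i j) x
           - partial j (christoffel g k i k) x)
   + \sum_k \sum_l (christoffel g k k l x * christoffel g l i j x
                    - christoffel g k j l x * christoffel g l i k x)).

Definition gradient g u x : 'rV[R]_n :=
  (\row_i partial i u x) *m invmx (g x).

Definition hessian g u x : 'M[R]_n := \matrix_(i, j)
  (partial i (partial j u) x - \sum_k christoffel g k i j x * partial k u x).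

Definition form (B : 'M[R]_n) (v w : 'rV[R]_n) : R := (v *m B *m w^T) ord0 ord0.

(* Inner product of covariant 2-tensors, g^{ia} g^{jb} A_{ij} B_{ab}. *)
Definition tensor_dot g x (A B : 'M[R]_n) : R :=
  \tr (invmx (g x) *m A *m invmx (g x) *m B^T).

Definition vol_density g x : R := Num.sqrt (\det (g x)).

Definition volume g (Omega : set 'rV[R]_n) : \bar R :=
  (\int[lebesgue_rV]_(x in Omega) (vol_density g x)%:E)%E.

Definition vintegral g (Omega : set 'rV[R]_n) u : R :=
  \int[lebesgue_rV]_(x in Omega) (u x * vol_density g x).

Definition curve_length g (c : R -> 'rV[R]_n) : \bar R :=
  (\int[lebesgue_measure]_(t in `[0%R, 1%R])
     (Num.sqrt (form (g (c t)) (derive1 c t) (derive1 c t)))%:E)%E.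

Definition C1_curve (H : set 'rV[R]_n) (p q : 'rV[R]_n) (c : R -> 'rV[R]_n) :=
  [/\ (forall t, derivable c t 1), continuous (derive1 c), c 0 = p, c 1 = q &
      forall t, t \in `[0, 1] -> H (c t)].

Definition riem_dist g (H : set 'rV[R]_n) (p q : 'rV[R]_n) : \bar R :=
  ereal_inf [set curve_length g c | c in [set c | C1_curve H p q c]].

End riemann.

Section biharmonic.
Context {R : realType} {n : nat}.
Variables (g : 'rV[R]_n -> 'M[R]_n) (Omega : set 'rV[R]_n).
Implicit Types (u v : 'rV[R]_n -> R) (s : nat -> 'rV[R]_n -> R).

Definition H2_density u x : R :=
  tensor_dot g x (hessian g u x) (hessian g u x)
  + form (g x) (gradient g u x) (gradient g u x) + u x ^+ 2.

Definition H2_smooth u : Prop := smooth_on Omega u /\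
  (\int[lebesgue_rV]_(x in Omega)
     (H2_density u x * vol_density g x)%:E < +oo)%E.

Definition H2_norm u : R := Num.sqrt (vintegral g Omega (H2_density u)).

(* The completion of the smooth functions of finite norm: an element of
   H^2(Omega) is a Cauchy sequence s of such functions, two sequences being
   identified when the norm of their difference tends to 0. *)
Definition H2 : set (nat -> 'rV[R]_n -> R) := [set s |
  (forall k, H2_smooth (s k)) /\
  forall e : R, 0 < e -> exists K, forall k l, (K <= k)%N -> (K <= l)%N ->
    H2_norm (s k \- s l) < e].

Definition H2_null s : Prop := H2_norm (s k) @[k --> \oo] --> (0 : R).

Definition energy_smooth u : R := vintegral g Omega (fun x =>
  tensor_dot g x (hessian g u x) (hessian g u x)
  + form (ricci g x) (gradient g u x) (gradient g u x)).

Definition energy s : R := limn (fun k => energy_smooth (s k)).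

Definition L2_sqnorm s : R :=
  limn (fun k => vintegral g Omega (fun x => s k x ^+ 2)).

Definition rayleigh s : R := energy s / L2_sqnorm s.

Definition lincomb j (c : 'rV[R]_j) (b : 'I_j -> nat -> 'rV[R]_n -> R) :
    nat -> 'rV[R]_n -> R :=
  fun k x => \sum_(i < j) c ord0 i * b i k x.

(* b is a basis of a j-dimensional subspace of H^2(Omega). *)
Definition H2_free j (b : 'I_j -> nat -> 'rV[R]_n -> R) : Prop :=
  (forall i, H2 (b i)) /\ forall c, H2_null (lincomb c b) -> c = 0.

(* Min-max over the j-dimensional subspaces U of H^2(Omega), each given by a
   basis b; the nonzero elements of U are the combinations with c != 0. The
   infimum and supremum are attained for bounded Omega with Lipschitz boundary;
   they are taken in \bar R so that the definition makes sense for any Omega. *)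
Definition neumann_eigenvalue (j : nat) : \bar R :=
  ereal_inf [set ereal_sup [set (rayleigh (lincomb c b))%:E |
                              c in [set c : 'rV[R]_j | c != 0]]
            | b in [set b : 'I_j -> nat -> 'rV[R]_n -> R | H2_free b]].

End biharmonic.

Section hyperbolic.
Context {R : realType} {n : nat}.

(* The model of the (n+1)-dimensional hyperbolic space; the last coordinate is
   the height. *)
Definition half_space : set 'rV[R]_n.+1 := [set x | 0 < x ord0 ord_max].

Definition hyp_metric (x : 'rV[R]_n.+1) : 'M[R]_n.+1 :=
  (x ord0 ord_max ^- 2)%:M.

Definition hyp_dist : 'rV[R]_n.+1 -> 'rV[R]_n.+1 -> \bar R :=
  riem_dist hyp_metric half_space.

Definition hyp_domain (Omega : set 'rV[R]_n.+1) : Prop :=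
  [/\ Omega `<=` half_space, open Omega, connected Omega & Omega !=set0].

Definition hyp_bounded (Omega : set 'rV[R]_n.+1) : Prop :=
  exists2 p, half_space p &
    exists r : R, forall x, Omega x -> (hyp_dist p x <= r%:E)%E.

(* The half-space is a global chart, so the local Lipschitz graphs are taken in
   its Euclidean coordinates: near each boundary point p, up to a rotation Q about p, Omega is the set of
   points lying below the graph of a Lipschitz function. *)
Definition lipschitz_boundary (Omega : set 'rV[R]_n.+1) : Prop :=
  forall p, half_space p -> closure Omega p -> ~ Omega p ->
  exists (Q : 'M[R]_n.+1) (phi : 'rV[R]_n -> R),
    [/\ Q *m Q^T = 1%:M, lipschitz phi &
        \forall x \near p,
          Omega x <-> ((x - p) *m Q) ord0 ord_max
                      < phi (col' ord_max ((x - p) *m Q))].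

End hyperbolic.

(* Main.v *)
From HB Require Import structures.
Require Import Defs.
From mathcomp Require Import all_boot all_order all_algebra.
From mathcomp Require Import all_classical all_reals all_analysis.
From mathcomp Require Import measurable_realfun ring lra.

Set Implicit Arguments.
Unset Strict Implicit.
Unset Printing Implicit Defensive.

Import Order.TTheory GRing.Theory Num.Theory.
Import numFieldNormedType.Exports.

Local Open Scope classical_set_scope.
Local Open Scope ring_scope.

(** In the half-space model of the hyperbolic space of dimension [d], with
    height [t], the function [slope a x = (x_0 - a) / t] is the restriction to
    the hyperboloid of a linear form on Minkowski space. Hence its Hessian is
    [slope a] times the metric, and its gradient has squared length
    [1 + slope a ^ 2]. As the Ricci tensor is [- (d - 1)] times the metric, the
    energy density of [f \o slope a] is, with [w = slope a x],

      [(f'' w * (1 + w ^ 2) + f' w * w) ^ 2 - (d - 1) * f' w ^ 2]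

    (lemma [energy_density_comp_slope]). If [f] is odd with [f' 0 <> 0], this
    is negative near [w = 0], and so is its sum with [M * f ^ 2]. The function
    [f] is taken smooth, odd and supported in [[-1, 1]] ([profile]).

    The domain is a tube around the horizontal line at height 2, the radius of
    which is a function of the abscissa: [N] small bulbs of radius [delta]
    centered at points [a] of the axis at mutual distance at least 8, joined by
    necks of radius [eps], followed by a cylinder of radius [r]. On the bulb
    around [a] the function [slope a] is so small that the shifted energy
    density is at most a negative constant. On the rest of the support of
    [f \o slope a] the domain is a neck, the volume of which vanishes with
    [eps], so that for [eps] small enough the whole integral is nonpositive
    ([tube_integral_le0]). At heights between 1 and 3 the supports of the
    functions [f \o slope a] attached to different bulbs are disjoint. Hence
    the energy is diagonal on their span, the Rayleigh quotient is at most [- M]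
    there, and the min-max principle bounds the first [N] eigenvalues
    ([neumann_eigenvalue_le]).

    The cylinder serves to adjust the volume: the other parts have volume less
    than 1, and the volume is an affine function of the length of the cylinder
    ([exists_unit_volume]). Finally, the tube has a Lipschitz boundary because
    the function that defines it is Lipschitz and increases at a definite rate
    along some direction near every boundary point: away from the axis where the
    radius is positive, and along the axis at the two tips, which are cones of
    slope 1 ([lipschitz_graph_of_transversal], [lipschitz_boundary_tube]). *)

(** * A smooth compactly supported profile *)

Lemma is_derive_expn (R : realType) k (x : R) :
  is_derive x (1 : R) (fun y : R => y ^+ k) (k%:R * x ^+ k.-1).
Proof.
apply: DeriveDef; first exact: exprn_derivable.
by rewrite exp_derive /GRing.scale /= mulr1.
Qed.

Section flat.
Context {R : realType}.
Implicit Types (k : nat) (x : R).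

(** The negative power is carried along so that the family is closed under
    differentiation: the derivative of [flat k] is a combination of
    [flat k.+1] and [flat k.+2]. *)
Definition flat k x : R := if 0 < x then x ^- k * expR (- x^-1) else 0.

Lemma flat_le0 k x : x <= 0 -> flat k x = 0.
Proof. by move=> x0; rewrite /flat ltNge x0. Qed.

Lemma flat_gt0 k x : 0 < x -> 0 < flat k x.
Proof.
by move=> x0; rewrite /flat x0 mulr_gt0 ?expR_gt0// invr_gt0 exprn_gt0.
Qed.

Lemma flat_ge0 k x : 0 <= flat k x.
Proof.
by have [x0|x0] := leP x 0; [rewrite flat_le0|rewrite ltW// flat_gt0].
Qed.

(** Since [y ^ (k + 2) * exp (- y) <= (k + 2)!], a flat function vanishes to
    second order at the origin. *)
Lemma flat_le_sqr k x : flat k x <= (k.+2)`!%:R * x ^+ 2.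
Proof.
have [x0|x0] := leP x 0.
  by rewrite flat_le0// mulr_ge0// sqr_ge0.
rewrite /flat x0 expRN.
have y0 : 0 <= x^-1 by rewrite invr_ge0 ltW.
have {y0} : x^-1 ^+ k.+2 / (k.+2)`!%:R <= expR x^-1.
  by apply: le_trans (expR_ge1Dxn k.+1 y0); rewrite lerDr.
set F := (_`!%:R : R); have F0 : 0 < F by rewrite ltr0n fact_gt0.
rewrite ler_pdivrMr// => le.
rewrite ler_pdivrMr ?expR_gt0// -exprVn.
have -> : x^-1 ^+ k = x^-1 ^+ k.+2 * x ^+ 2.
  by rewrite -addn2 exprD -mulrA -exprMn mulVf ?gt_eqF// expr1n mulr1.
by rewrite [leRHS]mulrAC ler_wpM2r ?sqr_ge0// mulrC.
Qed.

Lemma is_derive_flat k x :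
  is_derive x (1 : R) (flat k) (flat k.+2 x - k%:R * flat k.+1 x).
Proof.
have [x0|x0|->] := ltgtP x 0.
- rewrite !flat_le0 ?(ltW x0)// mulr0 subr0.
  apply: (@near_eq_is_derive _ _ _ (fun=> 0)).
  near=> y; rewrite flat_le0// ltW//; near: y; exact: lt_nbhsl.
- have xn0 : x != 0 by rewrite gt_eqF.
  have dX : is_derive x (1 : R) (fun y : R => y ^- k) (- (k%:R * x ^- k.+1)).
    have := @is_deriveV R (fun y : R => y ^+ k) x _ 1 (expf_neq0 k xn0)
              (is_derive_expn k x).
    move=> /is_derive_eq; apply; rewrite /GRing.scale /=.
    case: k => [|k]; first by rewrite !mul0r mulr0 oppr0.
    by rewrite /= !exprS; field; rewrite xn0 expf_neq0.
  have dE : is_derive x (1 : R) (fun y : R => expR (- y^-1))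
              (expR (- x^-1) * x ^- 2).
    apply: (@is_derive1_comp _ expR (fun y => - y^-1)).
    have := is_deriveN (@is_deriveV R id x _ 1 xn0 (is_derive_id x 1)).
    by move=> /is_derive_eq; apply; rewrite /GRing.scale /= mulr1 opprK.
  suff dF : is_derive x (1 : R) (fun y => y ^- k * expR (- y^-1))
      (flat k.+2 x - k%:R * flat k.+1 x).
    apply: near_eq_is_derive dF.
    near=> y; rewrite /flat ifT//; near: y; exact: lt_nbhsr.
  have := is_deriveM dX dE; move=> /is_derive_eq; apply.
  rewrite /flat x0 /GRing.scale /= !exprS; field.
  by rewrite xn0 expf_neq0.
- rewrite !flat_le0// mulr0 subr0.
  have lim0 : (fun h : R => h^-1 *: ((flat k \o shift 0) (h *: (1 : R)) - flat k 0))
      @ 0^' --> (0 : R).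
    apply/cvgrPdist_le => e e0; near=> h.
    rewrite sub0r normrN /= addr0 [flat k 0]flat_le0// subr0.
    rewrite /GRing.scale /= mulr1 normrM normfV [`|flat _ _|]ger0_norm ?flat_ge0//.
    have hn0 : h != 0 by near: h; exact: nbhs_dnbhs_neq.
    rewrite mulrC ler_pdivrMr ?normr_gt0//.
    apply: le_trans (flat_le_sqr k h) _; rewrite -real_normK ?num_real//.
    rewrite expr2 mulrA ler_wpM2r// -ler_pdivlMl ?ltr0n ?fact_gt0//.
    near: h; apply: dnbhs0_le; rewrite mulr_gt0// invr_gt0 ltr0n fact_gt0//.
  apply: DeriveDef; last exact: (cvg_lim _ lim0).
  by apply/cvg_ex; exists 0.
Unshelve. all: by end_near. Qed.

End flat.

Section profile.
Context {R : realType}.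
Implicit Types w : R.

(** The factor [w] makes the function odd, so that at the origin its second
    derivative vanishes and its first derivative does not. *)
Definition profile w : R := w * flat 0 (1 - w ^+ 2).
Definition profile1 w : R :=
  flat 0 (1 - w ^+ 2) - 2 * w ^+ 2 * flat 2 (1 - w ^+ 2).
Definition profile2 w : R :=
  w * ((8 * w ^+ 2) * - flat 3 (1 - w ^+ 2) + 4 * w ^+ 2 * flat 4 (1 - w ^+ 2)
       - 6 * flat 2 (1 - w ^+ 2)).

Let is_derive_flat_sqr k w : is_derive w (1 : R)
  (fun w => flat k (1 - w ^+ 2))
  ((flat k.+2 (1 - w ^+ 2) - k%:R * flat k.+1 (1 - w ^+ 2)) * (- (2 * w))).
Proof.
apply: (@is_derive1_comp _ (flat k) (fun w => 1 - w ^+ 2)).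
  exact: is_derive_flat.
have := is_deriveB (is_derive_cst (1 : R) w 1)
  (is_derive_expn 2 w).
by move=> /is_derive_eq; apply; rewrite /GRing.scale /= sub0r.
Qed.

Lemma is_derive_profile w : is_derive w (1 : R) profile (profile1 w).
Proof.
have := is_deriveM (is_derive_id w (1 : R)) (is_derive_flat_sqr 0 w).
by move=> /is_derive_eq; apply; rewrite /GRing.scale /= /profile1; ring.
Qed.

Lemma is_derive_profile1 w : is_derive w (1 : R) profile1 (profile2 w).
Proof.
have dw2 : is_derive w (1 : R) (fun w => 2 * w ^+ 2) (4 * w).
  have := is_deriveZ (2 : R) (is_derive_expn 2 w).
  by move=> /is_derive_eq; apply; rewrite /GRing.scale /=; ring.
have := is_deriveB (is_derive_flat_sqr 0 w)
  (is_deriveM dw2 (is_derive_flat_sqr 2 w)).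
by move=> /is_derive_eq; apply; rewrite /GRing.scale /= /profile2; ring.
Qed.

Let continuous_flat_sqr k : continuous (fun w : R => flat k (1 - w ^+ 2)).
Proof.
move=> w; apply/differentiable_continuous/derivable1_diffP.
by have [] := is_derive_flat_sqr k w.
Qed.

Lemma continuous_profile : continuous profile.
Proof.
move=> w; apply/differentiable_continuous/derivable1_diffP.
by have [] := is_derive_profile w.
Qed.

Lemma continuous_profile1 : continuous profile1.
Proof.
move=> w; apply/differentiable_continuous/derivable1_diffP.
by have [] := is_derive_profile1 w.
Qed.

Lemma continuous_profile2 : continuous profile2.
Proof.
move=> w; rewrite /continuous_at /profile2.
have cX : x ^+ 2 @[x --> w] --> w ^+ 2 by exact: exprn_continuous.
have cF k : flat k (1 - x ^+ 2) @[x --> w] --> flat k (1 - w ^+ 2).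
  exact: continuous_flat_sqr.
apply: cvgM; first exact: cvg_id.
apply: cvgB; last by apply: cvgM; [exact: cvg_cst|exact: cF].
apply: cvgD; apply: cvgM; [|exact: cvgN| |exact: cF];
  by apply: cvgM; [exact: cvg_cst|].
Qed.

Lemma profile_out w : 1 <= `|w| ->
  [/\ profile w = 0, profile1 w = 0 & profile2 w = 0].
Proof.
move=> w1; have w2 : 1 - w ^+ 2 <= 0.
  by rewrite subr_le0 -real_normK ?num_real// exprn_ege1.
by rewrite /profile /profile1 /profile2 !flat_le0// !(mulr0, oppr0, addr0).
Qed.

Lemma profile_neq0 w : 0 < w -> w < 1 -> profile w != 0.
Proof.
move=> w0 w1; rewrite mulf_neq0 ?gt_eqF// flat_gt0// subr_gt0.
by rewrite expr_lt1 ?ltW.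
Qed.

Lemma profile0 : profile 0 = 0. Proof. by rewrite /profile mul0r. Qed.

Lemma profile10 : profile1 0 != 0.
Proof.
by rewrite /profile1 expr0n/= mulr0 mul0r !subr0 gt_eqF// flat_gt0.
Qed.

Lemma profile20 : profile2 0 = 0. Proof. by rewrite /profile2 mul0r. Qed.

End profile.

(** * Smoothness of functions on the half-space *)

Section near_differentiable.
Context {R : numFieldType} {V W : normedModType R}.

Lemma near_eq_differentiable (f g : V -> W) (x : V) :
  (\near x, f x = g x) -> differentiable f x -> differentiable g x.
Proof.
move=> fg df; have [cf ef] := (diff_locallyP x f).1 df.
have gE : g \o shift x = cst (g x) + 'd f x +o_ (0 : V) id.
  apply/eqaddoP => e e0; move/eqaddoP : ef => /(_ e e0) ef.
  have {}fg : \forall y \near (0 : V), f (y + x) = g (y + x).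
    by move: fg; rewrite (near_shift 0) subr0.
  near=> y; have <- : (f \o shift x - (cst (f x) + 'd f x)) y =
      (g \o shift x - (cst (g x) + 'd f x)) y.
    rewrite !fctE /= (near fg y)//; congr (_ - (_ + _)).
    by have := nbhs_singleton fg; rewrite add0r.
  by near: y.
have dg := diff_unique cf gE.
by apply/diff_locallyP; rewrite dg.
Unshelve. all: by end_near. Qed.

End near_differentiable.

Lemma is_derive_comp1 (R : realType) (V : normedModType R) (f : R -> R)
    (u : V -> R) (x v : V) (a b : R) :
  is_derive (u x) (1 : R) f a -> differentiable u x -> 'D_v u x = b ->
  is_derive x v (f \o u) (a * b).
Proof.
move=> [df fa] du <-.
have dfu : differentiable (f \o u) x.
  by apply: differentiable_comp => //; exact/derivable1_diffP.
apply: DeriveDef; first exact: diff_derivable.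
rewrite deriveE// diff_comp//; last exact/derivable1_diffP.
by rewrite /= [in RHS]deriveE// deriv1E// derive1E fa /GRing.scale /= mulrC.
Qed.

Section half_space_smooth.
Context {R : realType} {n : nat}.
Local Notation V := 'rV[R]_n.+1.
Implicit Types (u v : V -> R) (x : V).

Lemma open_half_space : open (@half_space R n).
Proof.
apply: (open_comp (f := fun x : V => x ord0 ord_max) (D := [set t | 0 < t])).
  by move=> x _; exact: coord_continuous.
exact: open_gt.
Qed.

Lemma near_half_space x : half_space x -> \forall y \near x, half_space y.
Proof. by move=> Hx; exact: (open_nbhs_nbhs (conj open_half_space Hx)). Qed.

Lemma is_derive_coord i (x w : V) :
  is_derive x w (fun y => y ord0 i) (w ord0 i).
Proof.
apply: DeriveDef; first exact/diff_derivable/differentiable_coord.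
have := derive_mx (@derivable_id _ _ x w); rewrite derive_id.
by move=> /matrixP/(_ ord0 i); rewrite mxE.
Qed.

(** A class of functions that are visibly differentiable on the half-space and
    whose partial derivatives agree there with functions of the same class;
    this makes its members smooth without any bookkeeping of higher-order
    chain rules. *)
Inductive elementary : (V -> R) -> Prop :=
| elementary_cst c : elementary (fun=> c)
| elementary_coord i : elementary (fun x => x ord0 i)
| elementary_Vheight : elementary (fun x => (x ord0 ord_max)^-1)
| elementaryD u v : elementary u -> elementary v ->
    elementary (fun x => u x + v x)
| elementaryM u v : elementary u -> elementary v ->
    elementary (fun x => u x * v x)
| elementary_flat k u : elementary u -> elementary (fun x => flat k (u x)).

Lemma elementary_differentiable u x :
  elementary u -> half_space x -> differentiable u x.
Proof.
move=> eu Hx; elim: eu => {u}.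
- by move=> c; exact: differentiable_cst.
- by move=> i; exact: differentiable_coord.
- apply: differentiableV; first exact: differentiable_coord.
  by rewrite gt_eqF.
- by move=> u v _ du _ dv; exact: differentiableD.
- by move=> u v _ du _ dv; exact: differentiableM.
- move=> k u _ du; apply: (@differentiable_comp _ _ _ _ u (flat k)) => //.
  by apply/derivable1_diffP; have [] := is_derive_flat k (u x).
Qed.

Lemma is_derive_Vheight (x w : V) : half_space x ->
  is_derive x w (fun y => (y ord0 ord_max)^-1)
    (- x ord0 ord_max ^- 2 * w ord0 ord_max).
Proof.
move=> Hx; have xn0 : x ord0 ord_max != 0 by rewrite gt_eqF.
apply: (@is_derive_comp1 _ _ (fun t => t^-1)) => //.
- have := is_deriveV (f := id) xn0 (is_derive_id _ (1 : R)).
  by move=> /is_derive_eq; apply; rewrite /GRing.scale /= mulr1.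
- exact: differentiable_coord.
- by have [] := is_derive_coord ord_max x w.
Qed.

Lemma elementary_partial u i : elementary u ->
  exists2 v, elementary v & forall x, half_space x -> partial i u x = v x.
Proof.
elim => {u}.
- move=> c; exists (fun=> 0); first exact: elementary_cst.
  by move=> x _; rewrite /partial derive_cst.
- move=> j; exists (fun=> (delta_mx 0 i : V) ord0 j).
    exact: elementary_cst.
  by move=> x _; have [] := is_derive_coord j x (delta_mx ord0 i).
- pose t := fun x : V => (x ord0 ord_max)^-1.
  exists (fun x => -1 * (delta_mx 0 i : V) ord0 ord_max * (t x * t x)).
    do 2![apply: elementaryM]; [exact: elementary_cst..| |];
      exact: elementary_Vheight.
  move=> x Hx; have [_] := is_derive_Vheight (delta_mx ord0 i) Hx.
  rewrite /partial => ->; rewrite /t expr2 invfM; ring.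
- move=> u v eu [u' eu' u'E] ev [v' ev' v'E].
  exists (fun x => u' x + v' x); first exact: elementaryD.
  move=> x Hx; rewrite /partial.
  rewrite [LHS](@deriveD _ _ _ u v); [|exact/diff_derivable/elementary_differentiable..].
  by rewrite -[X in X + _]/(partial i u x) -[X in _ + X]/(partial i v x) u'E// v'E.
- move=> u v eu [u' eu' u'E] ev [v' ev' v'E].
  exists (fun x => u x * v' x + v x * u' x).
    by apply: elementaryD; exact: elementaryM.
  move=> x Hx; rewrite /partial.
  rewrite [LHS](@deriveM _ _ u v); [|exact/diff_derivable/elementary_differentiable..].
  by rewrite -u'E// -v'E.
- move=> k u eu [u' eu' u'E].
  exists (fun x => (flat k.+2 (u x) + - k%:R * flat k.+1 (u x)) * u' x).
    apply: elementaryM => //; apply: elementaryD; first exact: elementary_flat.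
    by apply: elementaryM; [exact: elementary_cst|exact: elementary_flat].
  move=> x Hx; rewrite mulNr -u'E//.
  by have [_] := is_derive_comp1 (is_derive_flat k (u x))
    (elementary_differentiable eu Hx) (erefl (partial i u x)).
Qed.

Lemma elementary_smooth_on (Omega : set V) u : Omega `<=` half_space ->
  elementary u -> smooth_on Omega u.
Proof.
move=> OH eu s x /OH Hx; suff [v ev vE] : exists2 v, elementary v &
    forall y, half_space y -> foldr partial u s y = v y.
  apply: near_eq_differentiable (elementary_differentiable ev Hx).
  by apply: filterS (near_half_space Hx) => y /vE.
elim: s => [|i s [v ev vE]] /=; first by exists u.
have [w ew wE] := elementary_partial i ev; exists w => // y Hy.
rewrite -wE//; apply: near_eq_derive.
by apply: filterS (near_half_space Hy) => z /vE.
Qed.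

End half_space_smooth.

(** * Riemannian calculus of the half-space metric *)

Section half_space_geometry.
Context {R : realType} {n : nat}.
Local Notation V := 'rV[R]_n.+1.
Local Notation m := (ord_max : 'I_n.+1).
Implicit Types (x : V) (i j k l p : 'I_n.+1).

Local Notation "x `t" := (x ord0 m) (at level 2, format "x `t").

Local Notation kron i j := ((i == j)%:R : R).

Let kronC i j : kron i j = kron j i. Proof. by rewrite eq_sym. Qed.

Let kronid i : kron i i = 1. Proof. by rewrite eqxx. Qed.

Let sum_kron i (F : 'I_n.+1 -> R) : \sum_j kron j i * F j = F i.
Proof.
rewrite (bigD1 i)//= kronid mul1r big1 ?addr0// => j ji.
by rewrite (negbTE ji) mul0r.
Qed.

Lemma invmx_hyp_metric x : half_space x -> invmx (hyp_metric x) = (x`t ^+ 2)%:M.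
Proof. by move=> Hx; rewrite /hyp_metric invmx_scalar invrK. Qed.

Lemma vol_density_hyp_metric x : half_space x ->
  vol_density hyp_metric x = x`t ^- n.+1.
Proof.
move=> Hx; have x0 : 0 <= x`t by exact: ltW.
rewrite /vol_density /hyp_metric det_scalar exprVn -exprM mulnC exprM -exprVn.
by rewrite sqrtr_sqr ger0_norm// invr_ge0 exprn_ge0.
Qed.

Let delta_m i : (delta_mx ord0 i : V) ord0 m = kron i m.
Proof. by rewrite mxE eqxx /= eq_sym. Qed.

Let partial_hyp_metric i j l x : half_space x ->
  partial i (fun y => hyp_metric y j l) x =
  - 2 * x`t ^- 3 * kron i m * kron j l.
Proof.
move=> Hx; have xn0 : x`t != 0 by rewrite gt_eqF.
pose f (y : V) : R := (y ord0 m)^-1.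
have df := is_derive_Vheight (delta_mx ord0 i) Hx.
have -> : (fun y => hyp_metric y j l) = kron j l *: (f * f).
  apply/funext => y; rewrite /hyp_metric mxE !fctE /= scaler_nat /f.
  by rewrite expr2 invfM.
have [_] := is_deriveZ (kron j l) (is_deriveM df df).
rewrite /partial => ->; rewrite delta_m /f /GRing.scale /=.
by field.
Qed.

(** Up to the factor [- 1 / t], the Christoffel symbols of the half-space. *)
Definition chr k i j : R := kron i m * kron j k + kron j m * kron i k
  - kron k m * kron i j.

Lemma christoffel_hyp_metric k i j x : half_space x ->
  christoffel hyp_metric k i j x = - (x`t)^-1 * chr k i j.
Proof.
move=> Hx; have xn0 : x`t != 0 by rewrite gt_eqF.
rewrite /christoffel invmx_hyp_metric//.
rewrite (eq_bigr (fun l => kron l k * (- 2 * (x`t)^-1 *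
  (kron i m * kron j l + kron j m * kron i l - kron l m * kron i j)))); last first.
  move=> l _; rewrite !partial_hyp_metric// mxE -[_ *+ (k == l)]mulr_natr.
  by rewrite (kronC k l); field.
by rewrite sum_kron /chr; field.
Qed.

Lemma sum_christoffel_hyp_metric i j x (F : V) : half_space x ->
  \sum_k christoffel hyp_metric k i j x * F ord0 k = - (x`t)^-1 *
    (kron i m * F ord0 j + kron j m * F ord0 i - kron i j * F ord0 m).
Proof.
move=> Hx; rewrite (eq_bigr (fun k =>
  kron k j * (- (x`t)^-1 * kron i m * F ord0 k)
  + kron k i * (- (x`t)^-1 * kron j m * F ord0 k)
  + kron k m * ((x`t)^-1 * kron i j * F ord0 k))); last first.
  move=> k _; rewrite christoffel_hyp_metric// /chr (kronC k i) (kronC k j).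
  by ring.
by rewrite !big_split /= !sum_kron; ring.
Qed.

Let partial_christoffel p k i j x : half_space x ->
  partial p (christoffel hyp_metric k i j) x = x`t ^- 2 * kron p m * chr k i j.
Proof.
move=> Hx; have xn0 : x`t != 0 by rewrite gt_eqF.
have -> : partial p (christoffel hyp_metric k i j) x =
    partial p ((- chr k i j) *: (fun y : V => (y ord0 m)^-1)) x.
  apply: near_eq_derive; apply: filterS (near_half_space Hx) => y Hy.
  by rewrite christoffel_hyp_metric// !fctE /GRing.scale /=; ring.
have [_] := is_deriveZ (- chr k i j) (is_derive_Vheight (delta_mx ord0 p) Hx).
by rewrite /partial => ->; rewrite delta_m /GRing.scale /=; field.
Qed.

(** Hyperbolic space is Einstein. *)
Lemma ricci_hyp_metric x : half_space x ->
  ricci hyp_metric x = - n%:R *: hyp_metric x.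
Proof.
move=> Hx; have xn0 : x`t != 0 by rewrite gt_eqF.
have chrV k i : chr k i k = kron i m.
  by rewrite /chr kronid; ring.
apply/matrixP => i j; rewrite !mxE.
have -> : \sum_k (partial k (christoffel hyp_metric k i j) x -
     partial j (christoffel hyp_metric k i k) x) =
     x`t ^- 2 * (chr m i j - n.+1%:R * (kron j m * kron i m)).
  rewrite (eq_bigr (fun k => kron k m * (x`t ^- 2 * chr k i j)
      - x`t ^- 2 * (kron j m * kron i m))); last first.
    by move=> k _; rewrite !partial_christoffel// chrV; ring.
  by rewrite big_split /= sum_kron sumrN sumr_const card_ord -mulr_natl; ring.
have -> : \sum_k \sum_l
     (christoffel hyp_metric k k l x * christoffel hyp_metric l i j x -
      christoffel hyp_metric k j l x * christoffel hyp_metric l i k x) =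
     x`t ^- 2 * (n.+1%:R * chr m i j -
       (n.+1%:R * (kron j m * kron i m) + chr m i j - chr j i m)).
  rewrite (eq_bigr (fun k => x`t ^- 2 * (chr m i j - kron j m * kron i m)
      - kron k j * (x`t ^- 2 * chr m i k) + kron k m * (x`t ^- 2 * chr j i k)));
      last first.
    move=> k _; rewrite (eq_bigr (fun l => kron l m * (x`t ^- 2 * chr l i j)
        + kron l k * (x`t ^- 2 * (chr l i j - kron j m * chr l i k))
        - kron l k * (x`t ^- 2 * chr l i j)
        - kron l m * (x`t ^- 2 * kron j k * chr l i k)
        + kron l j * (x`t ^- 2 * kron k m * chr l i k))); last first.
      move=> l _; rewrite !christoffel_hyp_metric//.
      by rewrite [chr k k l]/chr [chr k j l]/chr kronid (kronC k l) (kronC j l); field.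
    rewrite !big_split /= !sumrN !sum_kron chrV.
    by rewrite (kronC k j); ring.
  rewrite !big_split /= !sumrN !sum_kron sumr_const card_ord -mulr_natl.
  by ring.
rewrite /chr !kronid (kronC m j) /hyp_metric -mulr_natr -natr1.
by ring.
Qed.

End half_space_geometry.

Section slope.
Context {R : realType} {n : nat}.
Local Notation V := 'rV[R]_n.+2.
Local Notation m := (ord_max : 'I_n.+2).
Implicit Types (x : V) (i j k : 'I_n.+2) (a : R).
Local Notation "x `t" := (x ord0 m) (at level 2, format "x `t").

Definition slope a x : R := (x ord0 ord0 - a) / x`t.

(** The differential of [slope a]. *)
Definition dslope a x : V :=
  (x`t)^-1 *: (delta_mx ord0 ord0 - slope a x *: delta_mx ord0 m).

Lemma differentiable_slope a x : half_space x -> differentiable (slope a) x.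
Proof.
move=> Hx; apply: differentiableM.
  apply: (@differentiableB _ _ _ (fun y : V => y ord0 ord0) (cst a)).
    exact: differentiable_coord.
  exact: differentiable_cst.
apply: differentiableV; first exact: differentiable_coord.
by rewrite gt_eqF.
Qed.

Lemma partial_slope a i x : half_space x ->
  partial i (slope a) x = dslope a x ord0 i.
Proof.
move=> Hx; have xn0 : x`t != 0 by rewrite gt_eqF.
have [_] := is_deriveM
  (is_deriveB (is_derive_coord ord0 x (delta_mx ord0 i)) (is_derive_cst a x _))
  (is_derive_Vheight (delta_mx ord0 i) Hx).
move=> dE; rewrite [LHS]dE /dslope !mxE /GRing.scale /= ?eqxx /=.
by rewrite !fctE /cst /slope (eq_sym ord0 i) (eq_sym m i); field.
Qed.

Let is_derive_dslope a i j x : half_space x ->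
  is_derive x (delta_mx ord0 i) (fun y => dslope a y ord0 j) (- (x`t)^-1 *
    ((i == m)%:R * dslope a x ord0 j + (j == m)%:R * dslope a x ord0 i)).
Proof.
move=> Hx; have xn0 : x`t != 0 by rewrite gt_eqF.
have ds : is_derive x (delta_mx ord0 i) (slope a) (dslope a x ord0 i).
  rewrite -partial_slope//; apply/derivableP/diff_derivable.
  exact: differentiable_slope.
have dF := is_deriveM (is_derive_Vheight (delta_mx ord0 i) Hx)
  (is_deriveB (is_derive_cst ((ord0 == j)%:R : R) x _)
     (is_deriveZ ((m == j)%:R : R) ds)).
rewrite (_ : (fun y => _) = (fun y : V => (y`t)^-1) *
    (cst (ord0 == j)%:R - (m == j)%:R *: slope a)); last first.
  apply/funext => y; rewrite /dslope !mxE !fctE /GRing.scale /= ?eqxx /=.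
  by rewrite (eq_sym j ord0) (eq_sym j m) [slope a y * _]mulrC.
move: dF => /is_derive_eq; apply; rewrite !fctE /GRing.scale /= /dslope !mxE.
rewrite ?eqxx /= (eq_sym m j) (eq_sym i m) (eq_sym ord0 j) /GRing.scale /=.
by field.
Qed.

Lemma dslope_sqr a x : half_space x ->
  dslope a x *m (dslope a x)^T = ((1 + slope a x ^+ 2) / x`t ^+ 2)%:M.
Proof.
move=> Hx; have xn0 : x`t != 0 by rewrite gt_eqF.
have m0 : (m == ord0 :> 'I_n.+2) = false by [].
rewrite /dslope [_^T]linearZ /= -scalemxAl -scalemxAr scalerA.
rewrite [_^T]linearB /= [(slope a x *: _)^T]linearZ /= !trmx_delta.
rewrite mulmxBl !mulmxBr -!scalemxAl -!scalemxAr.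
rewrite !mul_delta_mx_cond m0 (eq_sym ord0) m0 !eqxx !mulr0n !mulr1n !scaler0.
apply/matrixP => i j; rewrite !mxE !ord1 !eqxx /=.
by field.
Qed.

Section composition.
Variables (f f1 f2 : R -> R).
Hypothesis df : forall w : R, is_derive w (1 : R) f (f1 w).
Hypothesis df1 : forall w : R, is_derive w (1 : R) f1 (f2 w).
Variables (a : R) (u : V -> R) (x : V).
Hypothesis Hx : half_space x.
Hypothesis uE : \forall y \near x, u y = f (slope a y).

Let partial_comp i y : half_space y ->
  partial i (f \o slope a) y = f1 (slope a y) * dslope a y ord0 i.
Proof.
move=> Hy; have [_ dE] := is_derive_comp1 (df (slope a y))
  (differentiable_slope a Hy) (partial_slope a i Hy).
exact: dE.
Qed.

Let near_comp : \forall y \near x, half_space y /\ \near y, u y = f (slope a y).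
Proof. exact: filterI (near_half_space Hx) (nbhs_interior uE). Qed.

Lemma gradient_comp_slope : gradient hyp_metric u x =
  (f1 (slope a x) * x`t ^+ 2) *: dslope a x.
Proof.
rewrite /gradient invmx_hyp_metric// mul_mx_scalar.
apply/rowP => i; rewrite !mxE /partial (near_eq_derive _ uE).
by rewrite -/(partial i (f \o slope a) x) partial_comp// !mxE; ring.
Qed.

(** The function [slope a] is the restriction of a Minkowski-linear form to
    the hyperboloid, so that its Hessian is [slope a] times the metric. *)
Lemma hessian_comp_slope : hessian hyp_metric u x =
  f2 (slope a x) *: ((dslope a x)^T *m dslope a x)
  + (f1 (slope a x) * slope a x) *: hyp_metric x.
Proof.
have xn0 : x`t != 0 by rewrite gt_eqF.
have uxE := nbhs_singleton near_comp.
apply/matrixP => i j; rewrite !mxE big_ord1 !mxE.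
have du k : partial k u x = (f1 (slope a x) *: dslope a x) ord0 k.
  by rewrite mxE -partial_comp// /partial (near_eq_derive _ uE).
have -> : partial i (partial j u) x =
    f1 (slope a x) * (- (x`t)^-1 * ((i == m)%:R * dslope a x ord0 j
      + (j == m)%:R * dslope a x ord0 i))
    + dslope a x ord0 j * (f2 (slope a x) * dslope a x ord0 i).
  have -> : partial i (partial j u) x =
      partial i ((f1 \o slope a) * (fun y => dslope a y ord0 j)) x.
    apply: near_eq_derive; apply: filterS near_comp => y [Hy uyE].
    by rewrite /partial (near_eq_derive _ uyE) -/(partial j (f \o slope a) y) partial_comp.
  have d1 := is_derive_comp1 (df1 (slope a x))
    (differentiable_slope a Hx) (partial_slope a i Hx).
  have [_ dE] := is_deriveM d1 (is_derive_dslope a i j Hx).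
  by rewrite [LHS]dE /GRing.scale.
under eq_bigr => k _ do rewrite du.
rewrite sum_christoffel_hyp_metric// /hyp_metric !mxE -[x`t ^- 2 *+ _]mulr_natr.
by rewrite !eqxx (_ : (m == ord0) = false)//=; field.
Qed.

Lemma tensor_dot_hessian_comp_slope :
  tensor_dot hyp_metric x (hessian hyp_metric u x) (hessian hyp_metric u x) =
  (f2 (slope a x) * (1 + slope a x ^+ 2)) ^+ 2
  + 2 * (f2 (slope a x) * (1 + slope a x ^+ 2)) * (f1 (slope a x) * slope a x)
  + n.+2%:R * (f1 (slope a x) * slope a x) ^+ 2.
Proof.
have xn0 : x`t != 0 by rewrite gt_eqF.
rewrite /tensor_dot hessian_comp_slope invmx_hyp_metric//.
set d := dslope a x; set p := f2 _; set w := slope a x; set q := _ * w.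
rewrite mul_mx_scalar mul_scalar_mx scalerA -scalemxAl mxtraceZ.
have dE : d *m d^T = ((1 + w ^+ 2) / x`t ^+ 2)%:M by exact: dslope_sqr.
clearbody d p q w.
have trd : \tr (d^T *m d) = (1 + w ^+ 2) / x`t ^+ 2.
  by rewrite mxtrace_mulC dE mxtrace_scalar.
have -> : (p *: (d^T *m d) + q *: hyp_metric x)^T =
    p *: (d^T *m d) + q *: hyp_metric x.
  rewrite /hyp_metric linearD /= [(p *: _)^T]linearZ [(q *: _)^T]linearZ /=.
  by rewrite trmx_mul trmxK tr_scalar_mx.
rewrite /hyp_metric mulmxDl !mulmxDr -!scalemxAl -!scalemxAr.
rewrite -(mulmxA d^T) (mulmxA d) dE !(mul_mx_scalar, mul_scalar_mx).
rewrite -scalemxAr !mxtraceD !mxtraceZ trd mxtrace_scalar -mulr_natl.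
by field.
Qed.

Lemma form_gradient_comp_slope :
  Defs.form (hyp_metric x) (gradient hyp_metric u x) (gradient hyp_metric u x) =
  f1 (slope a x) ^+ 2 * (1 + slope a x ^+ 2).
Proof.
have xn0 : x`t != 0 by rewrite gt_eqF.
rewrite /Defs.form gradient_comp_slope /hyp_metric mul_mx_scalar [_^T]linearZ /=.
move: (dslope a x) (dslope_sqr a Hx) => d dE.
rewrite -!scalemxAl -scalemxAr dE.
by rewrite !scale_scalar_mx mxE eqxx mulr1n; field.
Qed.

(** The squared Hessian and the Ricci term contribute [n.+2] and [- n.+1] times
    the square of [f1 w * w]; what is left over completes the square of the
    first term, and the only negative part is that of the Ricci term. *)
Lemma energy_density_comp_slope :
  tensor_dot hyp_metric x (hessian hyp_metric u x) (hessian hyp_metric u x)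
  + Defs.form (ricci hyp_metric x) (gradient hyp_metric u x)
      (gradient hyp_metric u x) =
  (f2 (slope a x) * (1 + slope a x ^+ 2) + f1 (slope a x) * slope a x) ^+ 2
  - n.+1%:R * f1 (slope a x) ^+ 2.
Proof.
have -> : Defs.form (ricci hyp_metric x) (gradient hyp_metric u x)
    (gradient hyp_metric u x) = - n.+1%:R *
    (f1 (slope a x) ^+ 2 * (1 + slope a x ^+ 2)).
  rewrite -form_gradient_comp_slope /Defs.form ricci_hyp_metric//.
  by rewrite -scalemxAr -scalemxAl mxE.
by rewrite tensor_dot_hessian_comp_slope -[n.+2%:R]natr1; ring.
Qed.

Lemma H2_density_comp_slope : H2_density hyp_metric u x =
  (f2 (slope a x) * (1 + slope a x ^+ 2) + f1 (slope a x) * slope a x) ^+ 2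
  + n.+1%:R * (f1 (slope a x) * slope a x) ^+ 2
  + f1 (slope a x) ^+ 2 * (1 + slope a x ^+ 2) + f (slope a x) ^+ 2.
Proof.
rewrite /H2_density tensor_dot_hessian_comp_slope form_gradient_comp_slope.
by rewrite (nbhs_singleton uE) -[n.+2%:R]natr1; ring.
Qed.

End composition.

End slope.

(** * Local Lipschitz graphs from a transversal direction *)

Section row_norm.
Context {R : realType} {n : nat}.
Implicit Types (v : 'rV[R]_n) (r : R).

Lemma row_norm_le v r : 0 <= r -> (`|v| <= r) = [forall i, `|v ord0 i| <= r].
Proof.
move=> r0; rewrite [`|v|]mx_normrE; apply/idP/forallP => [h i|h].
  by apply: le_trans h; exact: (le_bigmax _ (fun ij => `|v ij.1 ij.2|) (ord0, i)).
by apply: bigmax_le => // -[i j] _ /=; rewrite [i]ord1; exact: h.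
Qed.

Lemma row_norm_lt v r : 0 < r -> (`|v| < r) = [forall i, `|v ord0 i| < r].
Proof.
move=> r0; rewrite [`|v|]mx_normrE; apply/idP/forallP => [h i|h].
  by apply: le_lt_trans h; exact: (le_bigmax _ (fun ij => `|v ij.1 ij.2|) (ord0, i)).
by apply: bigmax_lt => // -[i j] _ /=; rewrite [i]ord1; exact: h.
Qed.

Lemma coord_le_norm v i : `|v ord0 i| <= `|v|.
Proof. by have := lexx `|v|; rewrite row_norm_le// => /forallP/(_ i). Qed.

End row_norm.

Lemma mulmx_lipschitz (R : realType) (m n : nat) (A : 'M[R]_(m, n)) :
  exists2 k : R, 0 < k & forall v : 'rV[R]_m, `|v *m A| <= k * `|v|.
Proof.
pose c : R := 1 + \sum_i \sum_j `|A i j|.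
have c0 : 0 < c.
  by rewrite ltr_pwDl// sumr_ge0// => i _; exact: sumr_ge0.
exists c => // v; rewrite row_norm_le ?mulr_ge0 ?(ltW c0)//; apply/forallP => j.
rewrite mxE; apply: le_trans (ler_norm_sum _ _ _) _.
rewrite mulrDl mul1r; apply: ler_wpDl => //.
rewrite mulr_suml; apply: ler_sum => i _; rewrite normrM mulrC.
apply: ler_pM => //; last exact: coord_le_norm.
by rewrite (bigD1 j)//= lerDl sumr_ge0.
Qed.

(** The Householder reflection exchanging the two unit vectors. *)
Lemma reflection_onto_last (R : realType) (n : nat) (v : 'rV[R]_n.+1) :
  v *m v^T = 1%:M ->
  exists Q : 'M[R]_n.+1, [/\ Q *m Q^T = 1%:M, Q^T = Q &
    v *m Q = delta_mx ord0 ord_max].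
Proof.
set e : 'rV[R]_n.+1 := delta_mx ord0 ord_max => v1.
have ee : e *m e^T = 1%:M.
  rewrite trmx_delta mul_delta_mx; apply/matrixP => i j.
  by rewrite !mxE !ord1.
have [->|vne] := eqVneq v e; first by exists 1%:M; rewrite trmx1 !mulmx1.
have [u uE] : exists u, u = v - e by exists (v - e).
pose s := v ord0 ord_max.
have ve : v *m e^T = s%:M.
  rewrite trmx_delta -colE; apply/matrixP => i j.
  by rewrite !mxE !ord1 eqxx mulr1n.
have ev : e *m v^T = s%:M.
  by rewrite -[LHS]trmxK trmx_mul trmxK ve tr_scalar_mx.
have uu : u *m u^T = (2 * (1 - s))%:M.
  rewrite uE linearB /= mulmxBl !mulmxBr v1 ee ve ev -!raddfB /=.
  by congr _%:M; ring.
have vu : v *m u^T = (1 - s)%:M.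
  by rewrite uE linearB /= mulmxBr v1 ve -raddfB.
have s1 : 1 - s != 0.
  apply: contraNneq vne => s0; rewrite -subr_eq0 -uE; apply/eqP/rowP => i.
  have := uu; rewrite s0 mulr0 => /matrixP/(_ ord0 ord0); rewrite !mxE /= mul0rn.
  move/eqP; rewrite psumr_eq0 => [/allP/(_ i)|j _]; rewrite !mxE; last first.
    by rewrite -expr2 sqr_ge0.
  by rewrite mem_index_enum -expr2 sqrf_eq0 => /(_ isT)/eqP.
pose Q := 1%:M - (1 - s)^-1 *: (u^T *m u).
have QT : Q^T = Q.
  by rewrite /Q linearB /= trmx1 [(_ *: _)^T]linearZ /= trmx_mul trmxK.
exists Q; split=> //.
  have PP : (u^T *m u) *m (u^T *m u) = (2 * (1 - s)) *: (u^T *m u).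
    by rewrite mulmxA -(mulmxA u^T) uu mul_mx_scalar -scalemxAl.
  rewrite QT /Q mulmxBl mul1mx mulmxBr mulmx1 -scalemxAl -scalemxAr PP !scalerA.
  rewrite (_ : (1 - s)^-1 / (1 - s) * _ = (1 - s)^-1 + (1 - s)^-1); last by field.
  by rewrite scalerDl opprB addrK subrK.
rewrite /Q mulmxBr mulmx1 -scalemxAr mulmxA vu mul_scalar_mx scalerA mulVf//.
by rewrite scale1r uE opprB addrC subrK.
Qed.

(** If [F] is Lipschitz and increases at a definite rate along the direction
    [v] near the zero [p], then near [p] the set [F < 0] lies below a Lipschitz
    graph over the hyperplane orthogonal to [v]. In coordinates in which [v] is
    the last basis vector, the graph is the upper envelope of the downward
    cones with vertices at the nearby points of [F < 0], the common slope of
    the cones being the ratio of the two rates. *)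
Lemma lipschitz_graph_of_transversal (R : realType) (n : nat)
    (F : 'rV[R]_n.+1 -> R) (L : R) (p v : 'rV[R]_n.+1) (eta kappa : R) :
  (forall x y, `|F x - F y| <= L * `|x - y|) -> F p = 0 ->
  v *m v^T = 1%:M -> 0 < eta -> 0 < kappa ->
  (forall x s, 0 <= s -> `|x - p| < eta -> `|x + s *: v - p| < eta ->
    F x + kappa * s <= F (x + s *: v)) ->
  exists (Q : 'M[R]_n.+1) (phi : 'rV[R]_n -> R),
    [/\ Q *m Q^T = 1%:M, lipschitz phi &
        \forall x \near p, F x < 0 <-> ((x - p) *m Q) ord0 ord_max
                      < phi (col' ord_max ((x - p) *m Q))].
Proof.
move=> FL Fp v1 eta0 kappa0 Fv.
have [Q [QQ QT vQ]] := reflection_onto_last v1.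
have {}QQ : Q *m Q = 1%:M by rewrite -[X in _ *m X]QT.
have [k k0 Qk] := mulmx_lipschitz Q.
have L0 : 0 <= L.
  have := le_trans (normr_ge0 _) (FL (p + v) p); rewrite addrC addKr.
  rewrite pmulr_lge0// normr_gt0; apply: contraTneq isT => v0.
  by move: v1; rewrite v0 mul0mx => /matrixP/(_ ord0 ord0)/eqP;
     rewrite !mxE eqxx eq_sym oner_eq0.
set e : 'rV[R]_n.+1 := delta_mx ord0 ord_max.
have eQ : e *m Q = v by rewrite /e -vQ -mulmxA QQ mulmx1.
pose G z := F (p + z *m Q).
pose rho := eta / k; have rho0 : 0 < rho by rewrite divr_gt0.
have GL x y : `|G x - G y| <= L * k * `|x - y|.
  rewrite -mulrA; apply: le_trans (FL _ _) _; apply: ler_wpM2l => //.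
  by rewrite opprD addrACA subrr add0r -mulmxBl Qk.
have Ge z s : 0 <= s -> `|z| < rho -> `|z + s *: e| < rho ->
    G z + kappa * s <= G (z + s *: e).
  move=> s0 zr zsr; rewrite /G mulmxDl -scalemxAl eQ addrA; apply: Fv => //.
    rewrite addrC addKr; apply: le_lt_trans (Qk _) _.
    by rewrite mulrC -ltr_pdivlMr.
  rewrite -[p + _ + _]addrA [p + _]addrC addrK -eQ scalemxAl -mulmxDl.
  by apply: le_lt_trans (Qk _) _; rewrite mulrC -ltr_pdivlMr.
pose C := L * k / kappa.
have C0 : 0 <= C by rewrite !mulr_ge0// ?invr_ge0 ltW.
pose Z := [set z : 'rV[R]_n.+1 | `|z| < rho /\ G z < 0].
pose S y := [set z ord0 ord_max - C * `|y - col' ord_max z| | z in Z].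
pose phi y := sup (S y).
have e1 : `|e| <= 1.
  rewrite row_norm_le//; apply/forallP => i; rewrite mxE.
  by case: (_ && _); rewrite ?normr0 ?normr1.
have S0 y : S y !=set0.
  pose z := - (rho / 2) *: e; exists (z ord0 ord_max - C * `|y - col' ord_max z|), z => //.
  have zr : `|z| < rho.
    rewrite normrZ normrN gtr0_norm ?divr_gt0// (@le_lt_trans _ _ (rho / 2))//.
      by rewrite ler_piMr// divr_ge0// ltW.
    by rewrite ltr_pdivrMr// ltr_pMr// ltr1n.
  split=> //; have := Ge z (rho / 2) (divr_ge0 (ltW rho0) (ler0n _ _)) zr.
  rewrite /z scaleNr addNr normr0 rho0 => /(_ isT).
  rewrite [G 0]/G mul0mx addr0 Fp => /le_lt_trans; rewrite -/z => h.
  rewrite -(ltrD2r (kappa * (rho / 2))) add0r; apply: h.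
  by rewrite mulr_gt0// divr_gt0.
have SB y : has_ubound (S y).
  exists rho => _ [z [zr _] <-]; rewrite lerBlDr ler_wpDr ?(mulr_ge0 C0 (normr_ge0 _))//.
  by apply: le_trans (ler_norm _) (le_trans (coord_le_norm _ _) _); exact: ltW.
have phiS y y' : phi y <= phi y' + C * `|y - y'|.
  apply: ge_sup => // _ [z Zz <-]; rewrite -lerBlDr.
  apply: le_trans (ub_le_sup (SB y') (imageP _ Zz)).
  rewrite -addrA lerD2l -opprD lerNl opprK -mulrDr ler_wpM2l//.
  rewrite [leRHS]addrC (distrC y y'); exact: ler_distD.
have zsE z s i : (z + s *: e) ord0 (lift ord_max i) = z ord0 (lift ord_max i).
  by rewrite !mxE (eq_sym _ ord_max) (negbTE (neq_lift _ _)) andbF mulr0 addr0.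
have zsmE z s : (z + s *: e) ord0 ord_max = z ord0 ord_max + s.
  by rewrite !mxE !eqxx mulr1.
exists Q, phi; split; first by rewrite QT.
  exists C; split; first exact: num_real.
  move=> c Cc [y y'] _ /=; rewrite ler_norml; apply/andP; split.
    rewrite lerNl opprB lerBlDl (le_trans (phiS y' y))// lerD2l distrC.
    by rewrite ler_wpM2r// ltW.
  by rewrite lerBlDl (le_trans (phiS y y'))// lerD2l ler_wpM2r// ltW.
near=> x; set z := (x - p) *m Q.
have xE : x = p + z *m Q by rewrite /z -mulmxA QQ mulmx1 addrC subrK.
have zr : `|z| < rho.
  rewrite (le_lt_trans (Qk _))// mulrC -ltr_pdivlMr//.
  rewrite distrC; near: x; apply: (@cvgr_dist_lt _ _ _ (nbhs p) _ id p) => //.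
  by rewrite divr_gt0.
rewrite xE -/(G z); clearbody z; split=> [Gz|].
  (* the set is open, so that the point itself can be pushed upwards *)
  have [s s0 [zs Gs]] : exists2 s, 0 < s & `|z + s *: e| < rho /\ G (z + s *: e) < 0.
    pose s := Num.min ((rho - `|z|) / 2) (- G z / (2 * (L * k + 1))).
    have Lk : 0 < 2 * (L * k + 1) by rewrite mulr_gt0// ltr_pwDr// mulr_ge0// ltW.
    have s0 : 0 < s.
      by rewrite lt_min !divr_gt0 ?subr_gt0 ?oppr_gt0.
    exists s => //; have se : `|s *: e| <= s by rewrite normrZ gtr0_norm// ler_piMr// ltW.
    split.
      apply: le_lt_trans (ler_normD _ _) _; rewrite -ltrBrDl.
      apply: le_lt_trans se _; apply: (@le_lt_trans _ _ ((rho - `|z|) / 2)).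
        by rewrite ge_min lexx.
      by rewrite ltr_pdivrMr// ltr_pMr ?subr_gt0// ltr1n.
    rewrite -[G _](subrK (G z)) -ltrBrDr sub0r; apply: le_lt_trans (ler_norm _) _.
    apply: le_lt_trans (GL _ _) _; rewrite [_ + s *: e]addrC addrK.
    apply: (@le_lt_trans _ _ (L * k * s)); first by rewrite ler_wpM2l// mulr_ge0// ltW.
    have sG : s * (2 * (L * k + 1)) <= - G z by rewrite -ler_pdivlMr// ge_min lexx orbT.
    apply: lt_le_trans sG; have := mulr_ge0 L0 (ltW k0); nra.
  apply: (@lt_le_trans _ _ ((z + s *: e) ord0 ord_max)).
    by rewrite zsmE ltrDl.
  apply: (ub_le_sup (SB _)); exists (z + s *: e) => //.
  rewrite (_ : _ - col' _ _ = 0) ?normr0 ?mulr0 ?subr0//.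
  apply/rowP => i; rewrite mxE [in X in _ + X]mxE [X in X - _]mxE.
  by rewrite [X in _ - X]mxE zsE subrr mxE.
move=> /(sup_gt (S0 _)) [_ [y [yr Gy] <-]] zy.
set d := `|_| in zy; pose s := y ord0 ord_max - z ord0 ord_max.
have Cds : C * d < s by rewrite /s ltrBrDr addrC -ltrBrDr.
have s0 : 0 <= s by apply: ltW; apply: le_lt_trans Cds; exact: mulr_ge0 C0 (normr_ge0 _).
have zsm : (z + s *: e) ord0 ord_max = y ord0 ord_max.
  by rewrite zsmE /s addrC subrK.
have zsr : `|z + s *: e| < rho.
  rewrite row_norm_lt//; apply/forallP => i; case: (unliftP ord_max i) => [j|] ->.
    by rewrite zsE (le_lt_trans (coord_le_norm _ _)).
  by rewrite zsm (le_lt_trans (coord_le_norm _ _)).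
have zsy : `|z + s *: e - y| <= d.
  rewrite row_norm_le ?normr_ge0//; apply/forallP => i; rewrite mxE [in X in _ + X]mxE.
  case: (unliftP ord_max i) => [j|] ->; last by rewrite zsm subrr normr0 normr_ge0.
  rewrite zsE; apply: le_trans (coord_le_norm _ j).
  by rewrite [in leRHS]mxE [in X in _ <= `|_ + X|]mxE !mxE.
have Gzs : G (z + s *: e) < L * k * d.
  rewrite -[G _](subrK (G y)) -[ltRHS]addr0; apply: ler_ltD => //.
  apply: le_trans (ler_norm _) (le_trans (GL _ _) _).
  by rewrite ler_wpM2l// mulr_ge0// ltW.
have := le_lt_trans (Ge z s s0 zr zsr) Gzs.
have : L * k * d <= kappa * s.
  rewrite -ler_pdivrMl// mulrA (mulrC kappa^-1); exact: ltW.
by lra.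
Unshelve. all: by end_near. Qed.

(** * Tubes around a horizontal segment *)

Lemma continuous_of_lipschitz (R : realType) (V W : normedModType R)
    (F : V -> W) (L : R) :
  (forall x y, `|F x - F y| <= L * `|x - y|) -> continuous F.
Proof.
move=> FL x; apply/cvgrPdist_lt => e e0; near=> y.
apply: le_lt_trans (FL x y) _; have L1 : 0 < `|L| + 1 by rewrite ltr_pwDr.
apply: (@le_lt_trans _ _ ((`|L| + 1) * `|x - y|)).
  by rewrite ler_wpM2r// (le_trans (ler_norm _))// lerDl.
rewrite mulrC -ltr_pdivlMr//; near: y.
by apply: (@cvgr_dist_lt _ _ _ (nbhs x) _ id x) => //; rewrite divr_gt0.
Unshelve. all: by end_near. Qed.

(** The inverse above height 1, continued to a continuous function. *)
Definition capped_inv (R : realType) (t : R) : R := (1 + `|t - 1|)^-1.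

Lemma capped_invE (R : realType) (t : R) : 1 <= t -> capped_inv t = t^-1.
Proof. by move=> t1; rewrite /capped_inv ger0_norm ?subr_ge0// addrC subrK. Qed.

Lemma continuous_capped_inv (R : realType) : continuous (@capped_inv R).
Proof.
move=> t; rewrite /continuous_at /capped_inv.
apply: cvgV; first by rewrite gt_eqF// ltr_pwDl.
apply: cvgD; first exact: cvg_cst.
by apply: cvg_norm; apply: cvgB; [exact: cvg_id|exact: cvg_cst].
Qed.

Section tube.
Context {R : realType} {n : nat}.
Local Notation V := 'rV[R]_n.+2.
Implicit Types (x y p v : V) (s t : R).

Definition tail x : 'rV[R]_n.+1 := \row_i x ord0 (lift ord0 i).

Lemma tail_cons s (w : 'rV[R]_n.+1) : tail (cons_rV (s, w)) = w.
Proof. by apply/rowP => i; rewrite mxE cons_rVS. Qed.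

Lemma tailB x y : tail (x - y) = tail x - tail y.
Proof. by apply/rowP => i; rewrite !mxE. Qed.

Lemma tail_norm_le x : `|tail x| <= `|x|.
Proof.
rewrite row_norm_le//; apply/forallP => i; rewrite mxE; exact: coord_le_norm.
Qed.

Lemma tail_last x : tail x ord0 ord_max = x ord0 ord_max.
Proof. by rewrite mxE; congr (x _ _); apply: val_inj. Qed.

(** The axis of the tube is at height 2, so that tubes of radius at most 1 stay
    between the heights 1 and 3. *)
Definition tube (h : R -> R) : set V :=
  [set x | `|tail x - const_mx 2| < h (x ord0 ord0)].

Let lineE m (a b : 'rV[R]_m) t i :
  (a + t *: b) ord0 i = a ord0 i + t * b ord0 i.
Proof. by rewrite mxE [X in _ + X]mxE. Qed.

Let subE m (a b : 'rV[R]_m) i : (a - b) ord0 i = a ord0 i - b ord0 i.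
Proof. by rewrite mxE [X in _ + X]mxE. Qed.

Let sqnormE m (a : 'rV[R]_m) : (a *m a^T) ord0 ord0 = \sum_i a ord0 i ^+ 2.
Proof. by rewrite mxE; apply: eq_bigr => i _; rewrite mxE. Qed.

Let form_hyp_metric x v : Defs.form (hyp_metric x) v v =
  x ord0 ord_max ^- 2 * (v *m v^T) ord0 ord0.
Proof. by rewrite /Defs.form /hyp_metric mul_mx_scalar -scalemxAl mxE. Qed.

Variable h : R -> R.
Hypothesis h_lip : forall s t, `|h s - h t| <= `|s - t|.
Hypothesis h_le1 : forall s, h s <= 1.

Lemma tube_height x : tube h x -> 1 < x ord0 ord_max < 3.
Proof.
move=> /lt_le_trans/(_ (h_le1 _)); rewrite row_norm_lt// => /forallP/(_ ord_max).
rewrite mxE tail_last !mxE.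
rewrite ltr_norml; lra.
Qed.

Lemma tube_half_space : tube h `<=` half_space.
Proof. by move=> x /tube_height/andP[+ _]; apply: lt_trans. Qed.

Let F x : R := `|tail x - const_mx 2| - h (x ord0 ord0).

Let tubeE x : tube h x <-> F x < 0.
Proof. by rewrite /F subr_lt0. Qed.

Let F_lip x y : `|F x - F y| <= 2 * `|x - y|.
Proof.
have -> : F x - F y = (`|tail x - const_mx 2| - `|tail y - const_mx 2|)
    + (h (y ord0 ord0) - h (x ord0 ord0)) by rewrite /F; ring.
apply: le_trans (ler_normD _ _) _; rewrite mulr_natl mulr2n lerD//.
  apply: le_trans (ler_dist_dist _ _) _.
  rewrite opprD addrACA subrr addr0 -tailB; exact: tail_norm_le.
apply: le_trans (h_lip _ _) _; rewrite distrC.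
by have := coord_le_norm (x - y) ord0; rewrite !mxE.
Qed.

Let F_continuous : continuous F.
Proof. exact: continuous_of_lipschitz F_lip. Qed.

Lemma open_tube : open (tube h).
Proof.
rewrite (_ : tube h = F @^-1` [set t | t < 0]).
  by apply: open_comp => [x _|]; [exact: F_continuous|exact: open_lt].
by apply/seteqP; split => x /= /tubeE.
Qed.

Let axis s : V := cons_rV (s, const_mx 2).

Section interval.
Variables A B : R.
Hypothesis h_gt0 : forall s, 0 < h s <-> A < s < B.

Lemma tube_bounds x : tube h x -> A < x ord0 ord0 < B.
Proof. by move=> /(le_lt_trans (normr_ge0 _))/h_gt0. Qed.

Let tube_axis s : A < s < B -> tube h (axis s).
Proof. by move=> /h_gt0 sh; rewrite /tube /= tail_cons subrr normr0 cons_rV0. Qed.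

Let connected_line (E : set R) (a b : V) : is_interval E ->
  connected [set a + t *: b | t in E].
Proof.
move=> /connected_intervalP cE; apply: connected_continuous_connected cE _.
apply: continuous_subspaceT => t; apply: cvgD; first exact: cvg_cst.
by apply: cvgZr_tmp; exact: cvg_id.
Qed.

(** Each point is joined inside its cross-section, which is convex, to the axis
    of the tube. *)
Lemma connected_tube : connected (tube h).
Proof.
pose seg x := [set axis (x ord0 ord0) + t *: (x - axis (x ord0 ord0)) | t in `[0, 1]].
pose ax := [set axis 0 + s *: (delta_mx ord0 ord0 : V) | s in `]A, B[].
have axE s : axis 0 + s *: (delta_mx ord0 ord0 : V) = axis s.
  apply/rowP => i; rewrite lineE [delta_mx _ _ _ _]mxE /axis.
  case: (unliftP ord0 i) => [j|] ->; first by rewrite !cons_rVS mulr0 addr0.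
  by rewrite !cons_rV0 mulr1 add0r.
have cax : connected ax by apply: connected_line; exact: interval_is_interval.
have -> : tube h = \bigcup_(x in tube h) (ax `|` seg x).
  apply/seteqP; split => [x tx|x [y ty [[s sAB <-]|[t t01 <-]]]].
  - exists x => //; right; exists 1; first by rewrite /= in_itv /= ler01 lexx.
    by rewrite scale1r addrC subrK.
  - by rewrite axE; apply: tube_axis; move: sAB; rewrite /= in_itv.
  - move: t01; rewrite /= in_itv /= => /andP[t0 t1].
    set z := _ + _; have -> : z = cons_rV (y ord0 ord0, const_mx 2 + t *: (tail y - const_mx 2)).
      apply/rowP => i; rewrite /z /axis lineE subE.
      case: (unliftP ord0 i) => [j|] ->; last by rewrite !cons_rV0 subrr mulr0 addr0.
      by rewrite !cons_rVS lineE subE !mxE.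
    rewrite /tube /= tail_cons cons_rV0 addrC addKr normrZ ger0_norm//.
    by apply: le_lt_trans ty; rewrite ler_piMl.
have [[x0 tx0]|tn] := pselect (tube h !=set0); last first.
  rewrite (_ : tube h = set0) ?bigcup_set0; first exact: connected0.
  by apply/eqP/negPn/negP => /set0P.
apply: bigcup_connected => [|x tx].
  exists (axis (x0 ord0 ord0)) => x tx; left; exists (x0 ord0 ord0) => //.
  by rewrite /= in_itv /= tube_bounds.
apply: connectedU => //; last by apply: connected_line; exact: interval_is_interval.
exists (axis (x ord0 ord0)); split.
  by exists (x ord0 ord0); [rewrite /= in_itv /= tube_bounds|exact: axE].
by exists 0; [rewrite /= in_itv /= lexx ler01|rewrite scale0r addr0].
Qed.

(** Along a straight segment that stays above height 1, the hyperbolic length is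
    at most the Euclidean one. *)
Lemma hyp_bounded_tube : hyp_bounded (tube h).
Proof.
pose p : V := const_mx 2; exists p; first by rewrite /half_space /= mxE.
pose K := `|A| + `|B| + 2; pose r := Num.sqrt (n.+2%:R * K ^+ 2).
exists r => x tx; set v := x - p.
have vK i : `|v ord0 i| <= K.
  rewrite /v !mxE; case: (unliftP ord0 i) => [j|] ->.
    apply: (@le_trans _ _ 1); last by rewrite /K; have := normr_ge0 A; have := normr_ge0 B; lra.
    move: tx => /lt_le_trans/(_ (h_le1 _))/ltW; rewrite row_norm_le//.
    by move=> /forallP/(_ j); rewrite !mxE.
  have /andP[Ax xB] := tube_bounds tx; rewrite /K ler_norml.
  by have := ler_norm A; have := ler_norm (- A); have := ler_norm B;
     have := ler_norm (- B); rewrite !normrN; lra.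
have vv : (v *m v^T) ord0 ord0 <= n.+2%:R * K ^+ 2.
  rewrite sqnormE -[n.+2 in leRHS]card_ord mulr_natl -sumr_const; apply: ler_sum => i _.
  rewrite -[leLHS]real_normK ?num_real//.
  by rewrite ler_sqr ?nnegrE ?vK// (le_trans (normr_ge0 _) (vK i)).
have vv0 : 0 <= (v *m v^T) ord0 ord0.
  by rewrite sqnormE sumr_ge0// => i _; exact: sqr_ge0.
pose c t : V := p + t *: v.
have dc t : is_derive t (1 : R) c v.
  have ds : is_derive t (1 : R) (fun s : R => s *: v) v.
    have [dv vE] := is_diff_scalel t v.
    apply: DeriveDef; first exact: diff_derivable.
    by rewrite deriveE// vE scale1r.
  have := is_deriveD (is_derive_cst p t 1) ds.
  by move=> /is_derive_eq; apply; rewrite add0r.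
have dcE : derive1 c = cst v.
  by apply/funext => t; rewrite derive1E; have [] := dc t.
have ct t : t \in `[0, 1] -> 1 <= c t ord0 ord_max.
  rewrite in_itv /= => /andP[t0 t1]; have /andP[x1 _] := tube_height tx.
  rewrite /c /v /p !mxE; nra.
apply: (@le_trans _ _ (curve_length hyp_metric c)).
  apply: ereal_inf_lbound; exists c => //; split.
  - by move=> t; have [] := dc t.
  - by rewrite dcE; exact: cst_continuous.
  - by rewrite /c scale0r addr0.
  - by rewrite /c scale1r /v addrC subrK.
  - by move=> t /ct; apply: lt_le_trans.
rewrite /curve_length dcE.
have -> : r%:E = (\int[@lebesgue_measure R]_(t in `[0%R, 1%R]) (cst r%:E t))%E.
  by rewrite integral_cst//= lebesgue_measure_itv/= lte_fin ltr01 -EFinD subr0 mule1.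
apply: ge0_le_integral => //.
- apply/measurable_EFinP.
  apply: (@eq_measurable_fun _ _ _ _ _ (fun t =>
      capped_inv (c t ord0 ord_max) * Num.sqrt ((v *m v^T) ord0 ord0))).
    move=> t /[!inE]/= t01; have := ct t t01; set a := c t _ _ => a1.
    have a0 : 0 < a by exact: lt_le_trans a1.
    rewrite capped_invE// form_hyp_metric -/a sqrtrM ?invr_ge0 ?exprn_ge0 ?(ltW a0)// -exprVn.
    by rewrite sqrtr_sqr ger0_norm// invr_ge0 ltW.
  apply: measurable_funTS; apply: continuous_measurable_fun => t.
  apply: cvgM; last exact: cvg_cst.
  have ct' : c s ord0 ord_max @[s --> t] --> c t ord0 ord_max.
    rewrite /c lineE (_ : (fun s => _) = fun s => p ord0 ord_max + s * v ord0 ord_max).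
      apply: cvgD; first exact: cvg_cst.
      by apply: cvgM; [exact: cvg_id|exact: cvg_cst].
    by apply/funext => s; rewrite lineE.
  exact: (cvg_comp _ _ ct' (@continuous_capped_inv R _)).
- move=> t /= t01; rewrite lee_fin /cst ler_sqrt; last exact: le_trans vv.
  apply: le_trans vv; rewrite form_hyp_metric.
  have := ct t t01; set a := c t _ _ => a1.
  by rewrite ler_piMl// invf_le1 ?exprn_gt0 ?exprn_ege1// (lt_le_trans _ a1).
Qed.

End interval.

(* [a] is a convex combination of [a + t *: b] and [a - b] *)
Let norm_ray (a b : 'rV[R]_n.+1) t : 0 <= t ->
  (1 + t) * `|a| <= `|a + t *: b| + t * `|a - b|.
Proof.
move=> t0; rewrite -[X in X * _]ger0_norm ?addr_ge0// -normrZ.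
rewrite -[X in X * `|_ - _|]ger0_norm// -normrZ.
apply: le_trans (ler_normD _ _); rewrite le_eqVlt; apply/orP; left.
by rewrite scalerBr scalerDl scale1r -addrA [t *: b + _]addrC subrK.
Qed.

(** The transversal direction: where the radius is positive, it is the position
    relative to the axis, along which the radius is constant while the distance
    to the axis increases by [norm_ray]; at a tip it is the direction of the
    axis pointing out of the tube, along which the radius decreases at rate 1. *)
Lemma lipschitz_boundary_tube :
  (forall s, h s = 0 -> exists2 sg : R, sg ^+ 2 = 1 &
     \forall t \near s, h t = sg * (t - s)) ->
  lipschitz_boundary (tube h).
Proof.
move=> h0 p _ cp ntp.
have Fp : F p = 0.
  apply/eqP; rewrite eq_le leNgt; apply/andP; split; last first.
    by rewrite leNgt; apply/negP => /tubeE.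
  apply/negP => Fp.
  have : nbhs p (F @^-1` [set t | 0 < t]).
    by apply: F_continuous; apply: open_nbhs_nbhs; split => //; exact: open_gt.
  by move=> /cp[x [/tubeE/ltW + /= Fx]]; rewrite leNgt Fx.
suff [v [eta [kappa [vv eta0 kappa0 Fv]]]] : exists v eta kappa,
    [/\ v *m v^T = 1%:M, 0 < eta, 0 < kappa &
     forall x s, 0 <= s -> `|x - p| < eta -> `|x + s *: v - p| < eta ->
       F x + kappa * s <= F (x + s *: v)].
  have [Q [phi [QQ phiL phiE]]] :=
    lipschitz_graph_of_transversal F_lip Fp vv eta0 kappa0 Fv.
  exists Q, phi; split=> //; apply: filterS phiE => x <-; exact: tubeE.
have hp : h (p ord0 ord0) = `|tail p - const_mx 2|.
  by apply/eqP; rewrite eq_sym -subr_eq0; exact/eqP.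
have [hp0|hp0] := eqVneq (h (p ord0 ord0)) 0.
  have [sg sg1 /nbhs_ballP[e e0 he]] := h0 _ hp0.
  exists (- sg *: delta_mx ord0 ord0), e, 1; split=> //.
    rewrite linearZ /= -scalemxAl -scalemxAr scalerA mulrNN -expr2 sg1 scale1r.
    by rewrite trmx_delta mul_delta_mx; apply/matrixP => i j; rewrite !ord1 !mxE.
  move=> x s s0 xp xsp; rewrite mul1r /F.
  have -> : tail (x + s *: (- sg *: delta_mx ord0 ord0)) = tail x.
    by apply/rowP => i; rewrite !mxE /= !mulr0 addr0.
  rewrite -addrA lerD2l he; last first.
    apply: le_lt_trans xp; have := coord_le_norm (x - p) ord0; rewrite !mxE.
    by rewrite distrC.
  rewrite he; last first.
    apply: le_lt_trans xsp; rewrite /= distrC.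
    by have := coord_le_norm (x + s *: (- sg *: delta_mx ord0 ord0) - p) ord0; rewrite !mxE.
  rewrite !mxE /= mulr1; have -> : sg * (x ord0 ord0 + s * - sg - p ord0 ord0) =
    sg * (x ord0 ord0 - p ord0 ord0) - s * sg ^+ 2 by ring.
  by rewrite sg1; lra.
pose q := tail p - const_mx 2.
have q0 : 0 < `|q| by rewrite lt_neqAle normr_ge0 andbT eq_sym -hp.
pose v : V := cons_rV (0, q); pose N := (v *m v^T) ord0 ord0.
have N0 : 0 < N.
  rewrite lt_neqAle; apply/andP; split; last first.
    by rewrite /N sqnormE sumr_ge0// => i _; exact: sqr_ge0.
  apply: contraTneq q0 => /esym/eqP; rewrite /N sqnormE psumr_eq0; last first.
    by move=> i _; exact: sqr_ge0.
  move=> /allP v0; rewrite (_ : q = 0) ?normr0 ?ltxx//; apply/rowP => i.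
  have := v0 (lift ord0 i) (mem_index_enum _).
  by rewrite cons_rVS sqrf_eq0 => /eqP ->; rewrite mxE.
have M0 : 0 < Num.sqrt N by rewrite sqrtr_gt0.
exists ((Num.sqrt N)^-1 *: v), (`|q| / 4), (`|q| / 2 / Num.sqrt N); split.
- rewrite linearZ /= -scalemxAl -scalemxAr scalerA -invfM -expr2 sqr_sqrtr ?ltW//.
  by rewrite [v *m _]mx11_scalar -/N scale_scalar_mx mulVf// gt_eqF.
- by rewrite divr_gt0.
- by rewrite !divr_gt0.
move=> x s s0 xp _; rewrite /F.
have -> : (x + s *: ((Num.sqrt N)^-1 *: v)) ord0 ord0 = x ord0 ord0.
  by rewrite lineE mxE cons_rV0 !mulr0 addr0.
rewrite addrAC lerD2r; set t := s / Num.sqrt N.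
have t0 : 0 <= t by rewrite divr_ge0// ltW.
have -> : tail (x + s *: ((Num.sqrt N)^-1 *: v)) - const_mx 2 =
    (tail x - const_mx 2) + t *: q.
  rewrite addrAC; congr (_ + _); apply/rowP => i.
  by rewrite scalerA mxE lineE cons_rVS lineE !mxE.
rewrite (_ : _ / _ * s = t * (`|q| / 2)); last by rewrite /t; ring.
set w := tail x - const_mx 2; have wq : `|w - q| < `|q| / 4.
  apply: le_lt_trans xp; rewrite /w /q opprB addrA subrK -tailB.
  exact: tail_norm_le.
have := norm_ray w q t0.
have wn : `|q| <= `|w| + `|w - q|.
  by rewrite -[X in `|X| <= _](subKr w) (le_trans (ler_normB _ _)).
by nra.
Qed.

End tube.

(** * Volume of a tube *)

Section translation.
Context {R : realType}.
Local Notation mu := (@lebesgue_measure R).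

Let shift_by (a : R) (x : measurableTypeR R) : measurableTypeR R := x - a.

Let measurable_shift (a : R) : measurable_fun setT (shift_by a).
Proof.
by apply: continuous_measurable_fun => x; apply: cvgB; [exact: cvg_id|exact: cvg_cst].
Qed.

Let shifted (a : R) : {measure set (measurableTypeR R) -> \bar R} :=
  measure_function_pushforward__canonical__measure_function_Measure mu
    (measurable_shift a).

Lemma lebesgue_measure_shift (a : R) (A : set (measurableTypeR R)) :
  measurable A ->
  pushforward mu (shift_by a) A = mu A.
Proof.
move=> mA; apply/esym; apply: (lebesgue_measure_unique (mu := shifted a)) => //.
move=> _ [[u v] _ <-] /=.
rewrite /pushforward (_ : _ @^-1` _ = `]u + a, v + a]%classic).
  rewrite !lebesgue_measure_itv/= !lte_fin ltrD2r.
  by case: ifPn => // _; rewrite -!EFinD; congr EFin; ring.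
by apply/seteqP; split => x /=; rewrite !in_itv /= ltrBrDr lerBlDr.
Qed.

Lemma ge0_integral_shift (a c : R) (f : R -> \bar R) :
  measurable_fun setT f -> (forall x, (0 <= f x)%E) ->
  (\int[mu]_(x in `](c + a)%R, +oo[) f (x - a)%R = \int[mu]_(x in `]c, +oo[) f x)%E.
Proof.
move=> mf f0; transitivity (\int[pushforward mu (shift_by a)]_(x in `]c, +oo[) f x)%E.
  rewrite ge0_integral_pushforward//.
  - congr integral; apply/seteqP; split => x /=; by rewrite !in_itv /= !andbT ltrBrDr.
  - exact: measurable_funTS.
apply: (@eq_measure_integral _ _ _ _ mu (shifted a)) => A mA _.
exact: (lebesgue_measure_shift a mA).
Qed.

End translation.

Section lebesgue_rV_fubini.
Context {R : realType} {n : nat}.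

Lemma ge0_integral_lebesgue_rVS (f : 'rV[R]_n.+1 -> \bar R) :
  measurable_fun setT f -> (forall x, (0 <= f x)%E) ->
  (\int[lebesgue_rV]_x f x =
   \int[lebesgue_measure]_s \int[lebesgue_rV]_w f (cons_rV (s, w)))%E.
Proof.
move=> mf f0.
have mc : measurable_fun setT (@cons_rV R n) by exact: measurable_cons_rV.
pose m : {measure set _ -> \bar R} := (@lebesgue_measure R \x @lebesgue_rV R n)%E.
have fE := @ge0_integral_pushforward _ _ _ _ _ _ mc m setT f measurableT mf.
transitivity (\int[m]_p (f \o @cons_rV R n) p)%E.
  by rewrite -[setT in RHS](preimage_setT (@cons_rV R n)) -fE// => x _; exact: f0.
apply: (@fubini_tonelli1 _ _ _ _ R lebesgue_measure lebesgue_rV) => [|p].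
  exact: measurableT_comp.
exact: f0.
Qed.

Lemma measurable_integral_cons_rV (f : 'rV[R]_n.+1 -> \bar R) :
  measurable_fun setT f -> (forall x, (0 <= f x)%E) ->
  measurable_fun setT
    (fun s : R => \int[lebesgue_rV]_w f (cons_rV (s, w)))%E.
Proof.
move=> mf f0; apply: (@measurable_fun_fubini_tonelli_F _ _ _ _ R lebesgue_rV
  (f \o @cons_rV R n)) => [|p]; last exact: f0.
by apply: measurableT_comp mf _; exact: measurable_cons_rV.
Qed.

End lebesgue_rV_fubini.

Section slices.
Context {R : realType} {n : nat}.
Local Notation V := 'rV[R]_n.+2.
Implicit Types (r s : R).

Let measurable_set_lt (f g : V -> R) : measurable_fun setT f ->
  measurable_fun setT g -> measurable [set x | f x < g x].
Proof.
move=> mf mg; rewrite (_ : mkset _ = setT `&` (g \- f) @^-1` `]0, +oo[%classic).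
  by apply: measurable_funB => //; exact: measurable_itv.
by rewrite setTI; apply/seteqP; split => x /=; rewrite in_itv /= andbT subr_gt0.
Qed.

Lemma measurable_tube (h : R -> R) : continuous h ->
  measurable (tube h : set V).
Proof.
move=> ch.
have mh : measurable_fun setT (fun x : V => h (x ord0 ord0)).
  apply: measurableT_comp (measurable_coord ord0).
  exact: continuous_measurable_fun.
rewrite (_ : tube h = [set x : V | 0 < h (x ord0 ord0)] `&`
   \big[setI/setT]_(i < n.+1)
     [set x : V | `|x ord0 (lift ord0 i) - 2| < h (x ord0 ord0)]).
  apply: measurableI.
    exact: measurable_set_lt.
  apply: bigsetI_measurable => i _.
  apply: measurable_set_lt => //; apply: measurableT_comp => //.
  by apply: measurable_funB => //; exact: measurable_coord.
rewrite -bigcap_seq; apply/seteqP; split=> x.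
  move=> tx; have h0 : 0 < h (x ord0 ord0) by exact: le_lt_trans tx.
  split=> // i _ /=; move: tx; rewrite /tube /= row_norm_lt// => /forallP/(_ i).
  by rewrite !mxE.
move=> [/= h0 hi]; rewrite /tube /= row_norm_lt//; apply/forallP => i.
by rewrite !mxE; apply: hi => /=; rewrite mem_index_enum.
Qed.

Let slab r : set 'rV[R]_n.+1 := [set w | `|w - const_mx 2| < r].

Let slabE r : 0 < r ->
  slab r = [set w | forall i, `]2 - r, 2 + r[%classic (w ord0 i)].
Proof.
move=> r0; apply/seteqP; split => w; rewrite /slab /= row_norm_lt//.
  by move=> /forallP wr i; have := wr i; rewrite !mxE ltr_distl in_itv.
by move=> wr; apply/forallP => i; have := wr i; rewrite !mxE ltr_distl in_itv.
Qed.

Let measurable_slab r : measurable (slab r).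
Proof.
have [r0|r0] := ltP 0 r.
  rewrite slabE//; apply: (@measurable_rect _ _ (fun=> `]2 - r, 2 + r[%classic)).
  by move=> i; exact: measurable_itv.
rewrite (_ : slab r = set0)//; apply/seteqP; split => w //= wr.
by have := lt_le_trans wr r0; rewrite ltNge normr_ge0.
Qed.

Let lebesgue_slab r : 0 < r -> lebesgue_rV (slab r) = ((2 * r) ^+ n.+1)%:E.
Proof.
move=> r0; rewrite slabE//.
rewrite (@lebesgue_rV_rect _ _ (fun=> `]2 - r, 2 + r[%classic))//.
under eq_bigr => i _.
  rewrite lebesgue_measure_itv/= lte_fin (_ : _ < _)%R; last by lra.
  rewrite -EFinD (_ : _ - _ = 2 * r); last by ring.
  over.
by rewrite prodEFin prodr_const card_ord.
Qed.

(** The volume of the cross-section of radius [r], per unit Euclidean length of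
    the axis. *)
Definition slice r : \bar R := (\int[@lebesgue_rV R n.+1]_(w in slab r)
  (capped_inv (w ord0 ord_max) ^+ n.+2)%:E)%E.

Let measurable_density m : measurable_fun setT
  (fun w : 'rV[R]_m.+1 => (capped_inv (w ord0 ord_max) ^+ n.+2)%:E).
Proof.
apply/measurable_EFinP; apply: measurable_funX.
apply: measurableT_comp (measurable_coord _).
by apply: continuous_measurable_fun; exact: continuous_capped_inv.
Qed.

Lemma slice_ge0 r : (0 <= slice r)%E.
Proof.
apply: integral_ge0 => w _; rewrite lee_fin exprn_ge0// invr_ge0.
by rewrite addr_ge0.
Qed.

Lemma slice_le0 r : r <= 0 -> slice r = 0%E.
Proof.
move=> r0; rewrite /slice (_ : slab r = set0) ?integral_set0//.
apply/seteqP; split => w //= wr.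
by have := lt_le_trans wr r0; rewrite ltNge normr_ge0.
Qed.

Lemma le_slice r s : r <= s -> (slice r <= slice s)%E.
Proof.
move=> rs; apply: ge0_subset_integral => //.
- by apply: measurable_funTS; exact: measurable_density.
- by move=> w _; rewrite lee_fin exprn_ge0// invr_ge0 addr_ge0.
- by move=> w /lt_le_trans; exact.
Qed.

Lemma slice_le r : 0 < r -> (slice r <= ((2 * r) ^+ n.+1)%:E)%E.
Proof.
move=> r0; rewrite -lebesgue_slab// -[leRHS]mul1e -integral_cst//.
apply: ge0_le_integral => //.
- by move=> w _; rewrite lee_fin exprn_ge0// invr_ge0 addr_ge0.
- by apply: measurable_funTS; exact: measurable_density.
- move=> w _; rewrite /= lee_fin exprn_ile1// ?invr_ge0 ?addr_ge0//.
  by rewrite invf_le1 ?ltr_pwDl// lerDl.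
Qed.

Lemma slice_gt0 r : 0 < r -> r <= 1 -> (0 < slice r)%E.
Proof.
move=> r0 r1; apply: (@lt_le_trans _ _ ((3^-1 ^+ n.+2)%:E * ((2 * r) ^+ n.+1)%:E)%E).
  by rewrite -EFinM lte_fin mulr_gt0// exprn_gt0 ?invr_gt0// mulr_gt0.
rewrite -lebesgue_slab// -integral_cst//.
apply: ge0_le_integral => //.
- by move=> w _; rewrite /= lee_fin exprn_ge0// invr_ge0.
- by apply: measurable_funTS; exact: measurable_density.
- move=> w /= wr; rewrite lee_fin lerXn2r ?nnegrE ?invr_ge0 ?addr_ge0//.
  rewrite lef_pV2 ?posrE ?ltr_pwDl//.
  have := coord_le_norm (w - const_mx 2) ord_max; rewrite !mxE => wm.
  have wm2 := le_lt_trans wm wr.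
  have := ler_normD (w ord0 ord_max - 2) 1; rewrite normr1.
  rewrite (_ : w ord0 ord_max - 2 + 1 = w ord0 ord_max - 1); last by ring.
  lra.
Qed.

Lemma volume_tube (h : R -> R) : (forall s t, `|h s - h t| <= `|s - t|) ->
  (forall s, h s <= 1) ->
  volume hyp_metric (tube h : set V) = (\int[lebesgue_measure]_s slice (h s))%E /\
  measurable_fun setT (slice \o h).
Proof.
move=> hL h1; have ch : continuous h.
  by apply: (@continuous_of_lipschitz _ _ _ h 1) => s t; rewrite mul1r.
have mt := measurable_tube ch.
pose G (x : V) := (capped_inv (x ord0 ord_max) ^+ n.+2)%:E.
have G0 x : (0 <= (G \_ (tube h)) x)%E.
  by rewrite patchE; case: ifP => // _; rewrite lee_fin exprn_ge0// invr_ge0 addr_ge0.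
have mG : measurable_fun setT (G \_ (tube h)).
  apply/(measurable_restrictT _ mt); apply: measurable_funTS.
  exact: measurable_density.
have sliceE s : (slice (h s) = \int[lebesgue_rV]_w (G \_ (tube h)) (cons_rV (s, w)))%E.
  rewrite /slice integral_mkcond; apply: eq_integral => w _.
  rewrite !patchE /G (_ : (cons_rV (s, w) \in tube h) = (w \in slab (h s))).
    rewrite (_ : ord_max = lift ord0 ord_max) ?cons_rVS//.
    exact: val_inj.
  by apply/idP/idP; rewrite !inE /tube /slab /= tail_cons cons_rV0.
split; last first.
  rewrite (_ : slice \o h = fun s => (\int[lebesgue_rV]_w (G \_ (tube h)) (cons_rV (s, w)))%E).
    exact: measurable_integral_cons_rV.
  by apply/funext => s; rewrite /= sliceE.
rewrite /volume; transitivity (\int[lebesgue_rV]_x (G \_ (tube h)) x)%E.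
  rewrite -integral_mkcond; apply: eq_integral => x /[!inE] tx.
  have /andP[x1 _] := tube_height h1 tx.
  rewrite /G vol_density_hyp_metric ?capped_invE ?exprVn ?(ltW x1)//.
  exact: tube_half_space tx.
rewrite ge0_integral_lebesgue_rVS//.
by apply: eq_integral => s _; rewrite sliceE.
Qed.

End slices.

(** * The radius of the domain *)

Section nonexpansive.
Context {R : realType}.
Implicit Types f g : R -> R.

Definition nonexpansive f := forall s t, f s <= f t + `|s - t|.

Lemma nonexpansive_lip f s t : nonexpansive f -> `|f s - f t| <= `|s - t|.
Proof.
by move=> fL; rewrite ler_distl lerBlDr; rewrite [X in _ && X]fL distrC fL.
Qed.

Lemma nonexpansive_cst c : nonexpansive (fun=> c).
Proof. by move=> s t; rewrite lerDl. Qed.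

Lemma nonexpansive_subr c : nonexpansive (fun t => t - c).
Proof. by move=> s t; have := ler_norm (s - t); lra. Qed.

Lemma nonexpansive_rsub c : nonexpansive (fun t => c - t).
Proof. by move=> s t; have := ler_norm (t - s); rewrite distrC; lra. Qed.

Lemma nonexpansive_tent c d : nonexpansive (fun t => c - `|t - d|).
Proof. by move=> s t; have := ler_distD s t d; rewrite (distrC t s); lra. Qed.

Lemma nonexpansive_max f g : nonexpansive f -> nonexpansive g ->
  nonexpansive (fun t => Num.max (f t) (g t)).
Proof.
move=> fL gL s t; rewrite ge_max; apply/andP; split.
  by apply: le_trans (fL s t) _; rewrite lerD2r le_max lexx.
by apply: le_trans (gL s t) _; rewrite lerD2r le_max lexx orbT.
Qed.

Lemma nonexpansive_min f g : nonexpansive f -> nonexpansive g ->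
  nonexpansive (fun t => Num.min (f t) (g t)).
Proof.
move=> fL gL s t; rewrite -lerBlDr le_min !lerBlDr; apply/andP; split.
  by apply: le_trans (fL s t); rewrite ge_min lexx.
by apply: le_trans (gL s t); rewrite ge_min lexx orbT.
Qed.

End nonexpansive.

Section radius.
Context {R : realType}.
Variables (N : nat) (delta eps r : R).
Hypothesis eps_gt0 : 0 < eps.
Hypothesis eps_le : eps <= delta.
Hypothesis delta_le : delta <= r.
Hypothesis r_le1 : r <= 1.
Implicit Types (L s t x : R) (i k : 'I_N).

(** The spacing 8 exceeds twice the half-width 3 of the region in which the slope
    relative to a center is at most 1 in absolute value, the height being less
    than 3. *)
Definition center (i : nat) : R := - (8 * i.+1%:R).
Definition left_end : R := - (8 * N.+1%:R).

Let bulbs x := \big[Num.max/eps]_(i < N) (delta - `|x - center i|).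

Let width x := Num.max eps (Num.max (Num.min r x) (bulbs x)).

(** A string of [N] bulbs of radius [delta], joined by necks of radius [eps],
    and a cylinder of radius [r] whose length is governed by [L]; both ends of
    the tube are closed by cones of slope 1. *)
Definition radius L x :=
  Num.min (x - left_end) (Num.min (2 * r + L - x) (width x)).

Let r_gt0 : 0 < r. Proof. by have := eps_gt0; have := eps_le; have := delta_le; lra. Qed.

Lemma center_dist i k : i != k -> 8 <= `|center i - center k|.
Proof.
move=> ik; rewrite /center opprK addrC -mulrBr normrM ger0_norm// ler_peMr//.
have : (i : nat) != k by [].
rewrite neq_ltn => /orP[lt|lt].
  rewrite ger0_norm ?subr_ge0 ?ler_nat ?ltnS ?(ltnW lt)//.
  by rewrite -natrB ?ler1n ?subn_gt0 ?ltnS// ltnW.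
rewrite distrC ger0_norm ?subr_ge0 ?ler_nat ?ltnS ?(ltnW lt)//.
by rewrite -natrB ?ler1n ?subn_gt0 ?ltnS// ltnW.
Qed.

Let center_range i : left_end + 8 <= center i <= - 8.
Proof.
have := ltn_ord i; rewrite -(ltr_nat R) -natr1 => iN.
have := ler0n R i; rewrite /left_end /center -!natr1.
have : (i%:R + 1 <= N%:R :> R) by rewrite natr1 ler_nat.
lra.
Qed.

Let left_end_le : left_end <= - 8.
Proof. by rewrite /left_end -natr1; have := ler0n R N; lra. Qed.

Let width_ge_eps x : eps <= width x.
Proof. by rewrite /width le_max lexx. Qed.

Let bulbs_le x c : eps <= c -> (forall i, delta - `|x - center i| <= c) ->
  bulbs x <= c.
Proof. by move=> ec h; apply: bigmax_le. Qed.

Let width_le x : width x <= r.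
Proof.
rewrite /width !ge_max ge_min lexx/= (le_trans eps_le delta_le)/=.
apply: bulbs_le => [|i]; first exact: le_trans eps_le delta_le.
by rewrite lerBlDr ler_wpDr.
Qed.

Let width_cylinder x : r <= x -> width x = r.
Proof.
move=> rx; apply/eqP; rewrite eq_le width_le /= /width !le_max !le_min rx lexx.
by rewrite /= orbT.
Qed.

Lemma radius_lip L s t : `|radius L s - radius L t| <= `|s - t|.
Proof.
apply: nonexpansive_lip; apply: nonexpansive_min; first exact: nonexpansive_subr.
apply: nonexpansive_min; first exact: nonexpansive_rsub.
apply: nonexpansive_max; first exact: nonexpansive_cst.
apply: nonexpansive_max.
  apply: nonexpansive_min; first exact: nonexpansive_cst.
  by move=> u v; have := nonexpansive_subr 0 u v; rewrite !subr0.
rewrite /bulbs; move=> u v; elim/big_ind2 : _ => [|a b c d ab cd|i _].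
- by rewrite lerDl.
- rewrite ge_max -!lerBlDr !le_max !lerBlDr ab/= cd orbT.
  by [].
- exact: nonexpansive_tent.
Qed.

Lemma radius_le L x : radius L x <= r.
Proof. by rewrite /radius !ge_min width_le !orbT. Qed.

Lemma radius_gt0 L x : 0 < radius L x <-> left_end < x < 2 * r + L.
Proof.
rewrite /radius !lt_min !subr_gt0 (lt_le_trans eps_gt0 (width_ge_eps x)) andbT.
by split.
Qed.

Lemma radius_tip L s : 0 <= L -> radius L s = 0 ->
  exists2 sg : R, sg ^+ 2 = 1 & \forall t \near s, radius L t = sg * (t - s).
Proof.
move=> L0 rs0; have tip0 t : eps <= width t by [].
have : s = left_end \/ s = 2 * r + L.
  move: rs0; rewrite /radius /Num.min; have := width_ge_eps s.
  have := eps_gt0; case: ifP => _; last case: ifP => _; move=> e0 we rs0.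
  - by left; lra.
  - by right; lra.
  - by exfalso; lra.
move=> [->|->]; [exists 1|exists (-1)]; rewrite ?expr1n ?sqrrN ?expr1n//.
  near=> t; have te : t - left_end < eps.
    rewrite ltrBlDr addrC; near: t; apply: lt_nbhsl.
    by rewrite ltrDl.
  rewrite mul1r /radius; apply/min_idPl; rewrite le_min.
  rewrite (le_trans (ltW te) (width_ge_eps t)) andbT.
  have := eps_le; have := delta_le; have := left_end_le; have := r_le1; lra.
near=> t; have te : 2 * r + L - t < eps.
  have : 2 * r + L - eps < t by near: t; apply: lt_nbhsr; rewrite ltrBlDr ltrDl.
  by lra.
rewrite mulN1r opprB /radius.
have -> : Num.min (2 * r + L - t) (width t) = 2 * r + L - t.
  by apply/min_idPl; exact: le_trans (ltW te) (width_ge_eps t).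
apply/min_idPr.
have := eps_le; have := delta_le; have := left_end_le; have := r_le1.
have := eps_gt0; lra.
Unshelve. all: by end_near. Qed.

Lemma radius_neck L x i : delta <= `|x - center i| -> `|x - center i| <= 3 ->
  radius L x <= eps.
Proof.
move=> dx x3; have /andP[_ ci] := center_range i.
have x0 : x <= eps by have := ler_norm (x - center i); have := eps_gt0; lra.
rewrite /radius !ge_min /width !ge_max lexx ge_min x0 orbT /=.
suff -> : bulbs x <= eps by rewrite !orbT.
apply: bulbs_le => // k; have [->|ki] := eqVneq k i.
  by have := eps_gt0; lra.
have := center_dist ki; have := ler_distD x (center k) (center i).
rewrite (distrC _ x); have := delta_le; have := r_le1; have := eps_gt0; lra.
Qed.

Lemma radius_bulb L x i : 0 <= L -> `|x - center i| <= delta / 2 ->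
  delta / 2 <= radius L x.
Proof.
move=> L0 xd; have /andP[lc c8] := center_range i.
have dr := delta_le; have r1 := r_le1; have r0 := r_gt0.
move: (xd); rewrite ler_distl => /andP[x1 x2].
rewrite /radius !le_min; apply/and3P; split; try lra.
rewrite /width !le_max; apply/orP; right; apply/orP; right.
apply: (@le_trans _ _ (delta - `|x - center i|)); first lra.
exact: (le_bigmax _ (fun i : 'I_N => delta - `|x - center i|)).
Qed.

(** Together with the next two lemmas, this makes the volume an affine function
    of [L]: increasing [L] only lengthens the cylinder and translates what comes
    after it. *)
Lemma radius_before L x : 0 <= L -> x <= r -> radius L x = radius 0 x.
Proof.
move=> L0 xr; rewrite /radius; congr Num.min.
by rewrite !(min_idPr _)//; have := width_le x; lra.
Qed.

Lemma radius_cylinder L x : r <= x -> x <= r + L -> radius L x = r.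
Proof.
move=> rx xL; rewrite /radius width_cylinder//.
have l8 := left_end_le; have r0 := r_gt0; have r1 := r_le1.
by rewrite !(min_idPr _)//; lra.
Qed.

Lemma radius_after L x : 0 <= L -> r + L <= x -> radius L x = radius 0 (x - L).
Proof.
move=> L0 xL; rewrite /radius !width_cylinder; try lra.
have l8 := left_end_le; have r0 := r_gt0; have r1 := r_le1.
have -> : 2 * r + 0 - (x - L) = 2 * r + L - x by ring.
have -> : Num.min (2 * r + L - x) r = 2 * r + L - x by apply/min_idPl; lra.
by rewrite !(min_idPr _)//; lra.
Qed.

End radius.

Section unit_volume.
Context {R : realType} {n : nat}.
Variables (N : nat) (delta eps r : R).
Hypothesis eps_gt0 : 0 < eps.
Hypothesis eps_le : eps <= delta.
Hypothesis delta_le : delta <= r.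
Hypothesis r_small : (8 * N.+1%:R + 2) * (2 * r) < 1.
Local Notation mu := (@lebesgue_measure R).
Local Notation rad := (radius N delta eps r).
Local Notation slc := (@slice R n).

Let r_gt0 : 0 < r. Proof. by move: eps_gt0 eps_le delta_le; lra. Qed.

Let r_le : 2 * r <= 1.
Proof.
have := ler0n R N.+1; move: r_small r_gt0; nra.
Qed.

Let volume_radius L : volume hyp_metric (tube (rad L) : set 'rV[R]_n.+2) =
  (\int[mu]_s slc (rad L s))%E /\ measurable_fun setT (slc \o rad L).
Proof.
apply: volume_tube; first exact: radius_lip.
move=> s; apply: le_trans (radius_le _ eps_le delta_le _ _) _.
by move: r_le r_gt0; lra.
Qed.

Let integral_split (f : R -> \bar R) (c : R) : measurable_fun setT f ->
  (forall x, (0 <= f x)%E) ->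
  (\int[mu]_x f x = \int[mu]_(x in `]-oo, c]) f x + \int[mu]_(x in `]c, +oo[) f x)%E.
Proof.
move=> mf f0.
rewrite -ge0_integral_setU//=.
- by rewrite itv_setU_setT.
- by apply: measurable_funTS.
- by apply/disj_setPS => x /= []; rewrite !in_itv /= andbT leNgt => /negP.
Qed.

Let measurable_rad L : measurable_fun setT (slc \o rad L).
Proof. by have [] := volume_radius L. Qed.

Let volume_affine L : 0 <= L -> (\int[mu]_s slc (rad L s) =
  \int[mu]_s slc (rad 0 s) + slc r * L%:E)%E.
Proof.
move=> L0; have r1 : r <= 1 by move: r_le r_gt0; lra.
have f0 M x : (0 <= slc (rad M x))%E by exact: slice_ge0.
have ra (x : R) : r + L < x -> slc (rad L x) = slc (rad 0 (x - L)).
  by move=> xL; rewrite (radius_after N eps_gt0 eps_le delta_le r1 L0 (ltW xL)).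
rewrite (integral_split r (measurable_rad L) (f0 L)).
rewrite [in RHS](integral_split r (measurable_rad 0) (f0 0)).
have itvE : `]r, +oo[%classic = `]r, r + L] `|` `]r + L, +oo[ :> set R.
  by rewrite -itv_bndbnd_setU// bnd_simp // lerDl.
rewrite [in LHS]itvE ge0_integral_setU//=; first last.
- by apply/disj_setPS => x /= []; rewrite !in_itv /= andbT => /andP[_]; rewrite leNgt => /negP.
- by apply: measurable_funTS; exact: measurable_rad.
have -> : (\int[mu]_(x in `]-oo, r]) slc (rad L x) =
    \int[mu]_(x in `]-oo, r]) slc (rad 0 x))%E.
  apply: eq_integral => x /[!inE]/=; rewrite in_itv /= => xr.
  by rewrite radius_before.
have -> : (\int[mu]_(x in `]r, (r + L)%R]) slc (rad L x) = slc r * L%:E)%E.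
  rewrite (eq_integral (cst (slc r))) => [|x /[!inE]/=]; last first.
    by rewrite in_itv /= => /andP[rx xL]; rewrite radius_cylinder// ltW.
  rewrite integral_cst//= lebesgue_measure_itv/= lte_fin ltrDl.
  have [L00|] := ltP 0 L; first by rewrite -EFinB addrAC subrr add0r.
  by move=> L_le0; rewrite (_ : L = 0)//; apply/eqP; rewrite eq_le L_le0.
have -> : (\int[mu]_(x in `](r + L)%R, +oo[) slc (rad L x) =
    \int[mu]_(x in `]r, +oo[) slc (rad 0 x))%E.
  have sh := @ge0_integral_shift R L r (slc \o rad 0) (measurable_rad 0) (f0 0).
  transitivity (\int[mu]_(x in `](r + L)%R, +oo[) (slc \o rad 0) (x - L)%R)%E;
    last exact: sh.
  apply: eq_integral => x /[!inE]/=; rewrite in_itv /= andbT => xL.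
  exact: ra.
by rewrite [X in (_ + X = _)%E]addeC addeA.
Qed.

(** Without its cylinder of length [L], the tube fits in one of radius [r] and
   Euclidean length at most [8 * N.+1 + 2]. *)
Let volume0 : (\int[mu]_s slc (rad 0 s) < 1)%E.
Proof.
have r1 : r <= 1 by move: r_le r_gt0; lra.
pose I := `]left_end N, 2 * r[%classic : set R.
have mI : measurable I by exact: measurable_itv.
apply: (@le_lt_trans _ _ (\int[mu]_s ((cst (slc r)) \_ I) s)%E).
  apply: ge0_le_integral => //.
  - by move=> x _; exact: slice_ge0.
  - exact: measurable_rad.
  - exact/(measurable_restrictT _ mI).
  move=> x _; rewrite patchE; case: ifPn => [_|].
    by apply: le_slice; exact: radius_le.
  rewrite notin_setE /I /= in_itv /= => xI.
  rewrite slice_le0// leNgt; apply/negP.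
  by move=> /(radius_gt0 N delta r eps_gt0); rewrite addr0.
rewrite -integral_mkcond integral_cst//= /I lebesgue_measure_itv/= lte_fin.
have l0 : left_end N <= 0 :> R by rewrite oppr_le0 mulr_ge0.
rewrite ifT; last by move: r_gt0; lra.
rewrite -EFinD opprK.
apply: (@le_lt_trans _ _ (((2 * r) ^+ n.+1)%:E * (2 * r + 8 * N.+1%:R)%:E)%E).
  rewrite lee_wpmul2r ?slice_le// lee_fin addr_ge0 ?mulr_ge0// ltW//.
rewrite -EFinM lte_fin; apply: le_lt_trans r_small; rewrite mulrC.
apply: ler_pM; rewrite ?addr_ge0 ?mulr_ge0 ?exprn_ge0 ?mulr_ge0 ?(ltW r_gt0)//.
  by move: r_le r_gt0; lra.
by rewrite exprS ler_piMr ?mulr_ge0 ?(ltW r_gt0)// exprn_ile1 ?mulr_ge0 ?(ltW r_gt0).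
Qed.

Lemma exists_unit_volume : exists2 L, 0 <= L &
  volume hyp_metric (tube (rad L) : set 'rV[R]_n.+2) = 1%E.
Proof.
have r1 : r <= 1 by move: r_le r_gt0; lra.
have s0 : (0 < slc r)%E by exact: slice_gt0.
have sr : (slc r <= ((2 * r) ^+ n.+1)%:E)%E by exact: slice_le.
have : (0 <= \int[mu]_s slc (rad 0 s))%E.
  by apply: integral_ge0 => s _; exact: slice_ge0.
move: volume0; case vE : (\int[mu]_s slc (rad 0 s))%E => [v| |]//.
rewrite lte_fin => v1 v0.
move: s0 sr; case sE : (slc r) => [s| |]//; rewrite lte_fin => s0 _.
have L0 : 0 <= (1 - v) / s by apply: divr_ge0; rewrite ?subr_ge0 ltW.
exists ((1 - v) / s) => //.
have [-> _] := volume_radius ((1 - v) / s).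
rewrite volume_affine// vE sE -EFinM -EFinD.
by congr EFin; field; rewrite gt_eqF.
Qed.

End unit_volume.

(** * Integrals over a tube of functions of the slope *)

Section boxes.
Context {R : realType} {n : nat}.
Local Notation V := 'rV[R]_n.+2.
Implicit Types (u v e : R).

Definition box u v e : set V :=
  [set x : V | u <= x ord0 ord0 <= v /\ `|tail x - const_mx 2| < e].

Let side u v e (i : 'I_n.+2) : set R :=
  if i == ord0 then `[u, v]%classic else `]2 - e, 2 + e[%classic.

Let boxE u v e : 0 < e -> box u v e = [set x : V | forall i, side u v e i (x ord0 i)].
Proof.
move=> e0; apply/seteqP; split => x; rewrite /box /= row_norm_lt//.
  move=> [x0 /forallP xt] i; case: (unliftP ord0 i) => [j|] ->; rewrite /side /=.
    by have := xt j; rewrite !mxE ltr_distl in_itv.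
  by rewrite in_itv.
move=> xs; split; first by have := xs ord0; rewrite /side /= in_itv.
apply/forallP => j; have := xs (lift ord0 j); rewrite /side /= in_itv /=.
by rewrite !mxE ltr_distl.
Qed.

Let measurable_side u v e i : measurable (side u v e i).
Proof. by rewrite /side; case: ifP => _; exact: measurable_itv. Qed.

Lemma measurable_box u v e : 0 < e -> measurable (box u v e).
Proof. by move=> e0; rewrite boxE//; exact: measurable_rect. Qed.

Lemma lebesgue_box u v e : 0 < e -> u < v ->
  lebesgue_rV (box u v e) = ((v - u) * (2 * e) ^+ n.+1)%:E.
Proof.
move=> e0 uv; rewrite boxE// lebesgue_rV_rect; last exact: measurable_side.
rewrite big_ord_recl /side /= EFinM; congr (_ * _)%E.
  by rewrite lebesgue_measure_itv/= lte_fin uv -EFinD.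
under eq_bigr => i _.
  rewrite /= lebesgue_measure_itv/= lte_fin (_ : _ < _)%R; last by lra.
  rewrite -EFinD (_ : _ - _ = 2 * e); last by ring.
  over.
by rewrite prodEFin prodr_const card_ord.
Qed.

End boxes.

Section tube_integrals.
Context {R : realType} {n : nat}.
Local Notation V := 'rV[R]_n.+2.
Local Notation lam := (@lebesgue_rV R n.+2).
Local Notation dvol := (vol_density hyp_metric).
Variable h : R -> R.
Hypothesis h_lip : forall s t, `|h s - h t| <= `|s - t|.
Hypothesis h_le1 : forall s, h s <= 1.
Variables A B : R.
Hypothesis AB : A < B.
Hypothesis h_supp : forall s, 0 < h s -> A < s < B.
Local Notation Om := (tube h : set V).
Implicit Types (x : V) (c w : R) (g : R -> R).

Let h_continuous : continuous h.
Proof. by apply: (@continuous_of_lipschitz _ _ _ h 1) => s t; rewrite mul1r. Qed.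

Let mOm : measurable Om. Proof. exact: measurable_tube. Qed.

Let Om_fin : (lam Om < +oo)%E.
Proof.
apply: (@le_lt_trans _ _ (lam (box A B 1))); last by rewrite lebesgue_box// ltry.
apply: le_measure; rewrite ?inE//; first exact: measurable_box.
move=> x tx; split; last exact: lt_le_trans tx _.
have /h_supp/andP[/ltW -> /ltW ->]// : 0 < h (x ord0 ord0).
exact: le_lt_trans tx.
Qed.

Let dvolE x : Om x -> dvol x = capped_inv (x ord0 ord_max) ^+ n.+2.
Proof.
move=> tx; have /andP[x1 _] := tube_height h_le1 tx.
rewrite capped_invE ?(ltW x1)// exprVn vol_density_hyp_metric//.
exact: tube_half_space tx.
Qed.

Let dvol_bounds x : Om x -> 3^-1 ^+ n.+2 <= dvol x <= 1.
Proof.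
move=> tx; have /andP[x1 x3] := tube_height h_le1 tx.
have x0 : 0 < x ord0 ord_max by exact: lt_trans x1.
rewrite dvolE// capped_invE ?(ltW x1)// lerXn2r ?nnegrE ?invr_ge0 ?(ltW x0)//=.
  by rewrite exprn_ile1 ?invr_ge0 ?(ltW x0)// invf_le1// ltW.
by rewrite lef_pV2 ?posrE// ltW.
Qed.

Lemma integrable_slope g (C : R) c : continuous g -> (forall w, `|g w| <= C) ->
  lam.-integrable Om (EFin \o (fun x => g (slope c x) * dvol x)).
Proof.
move=> cg gC; apply: measurable_bounded_integrable => //.
  apply: (@eq_measurable_fun _ _ _ _ _ (fun x =>
      g ((x ord0 ord0 - c) * capped_inv (x ord0 ord_max)) *
      capped_inv (x ord0 ord_max) ^+ n.+2)).
    move=> x /[!inE] tx; have /andP[x1 _] := tube_height h_le1 tx.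
    by rewrite dvolE// /slope -(capped_invE (ltW x1)).
  apply: measurable_funTS.
  have mi : measurable_fun setT (fun x : V => capped_inv (x ord0 ord_max)).
    apply: measurableT_comp (measurable_coord _).
    by apply: continuous_measurable_fun; exact: continuous_capped_inv.
  apply: measurable_funM; last exact: measurable_funX.
  apply: measurableT_comp; first exact: continuous_measurable_fun.
  apply: measurable_funM => //; apply: measurable_funB => //.
  exact: measurable_coord.
exists C; split; first exact: num_real.
move=> M CM x /= tx; have /andP[d0 d1] := dvol_bounds tx.
rewrite normrM (le_trans _ (ltW CM))// -[leRHS]mulr1 ler_pM//.
by rewrite ger0_norm// (le_trans _ d0)// exprn_ge0// invr_ge0.
Qed.

Let integrable_indic (a : R) (E : set V) : measurable E ->
  lam.-integrable Om (EFin \o (fun x => a * \1_E x)).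
Proof.
move=> mE; apply: measurable_bounded_integrable => //.
  by apply: measurable_funTS; apply: measurable_funM.
exists `|a|; split; first exact: num_real.
move=> M aM x /= _; rewrite normrM (le_trans _ (ltW aM))// ler_piMr//.
by rewrite indicE; case: (_ \in _); rewrite ?normr0 ?normr1.
Qed.

Let Rintegral_indic (a : R) (E : set V) : measurable E ->
  \int[lam]_(x in Om) (a * \1_E x) = a * fine (lam (E `&` Om)).
Proof.
move=> mE; rewrite RintegralZl//; last first.
  by have := integrable_indic 1 mE; under eq_fun do rewrite mul1r.
by congr (_ * _); rewrite /Rintegral integral_indic.
Qed.

Section bulb.
Variables (c delta : R).
Hypothesis delta_gt0 : 0 < delta.
Hypothesis h_bulb : forall s, `|s - c| <= delta / 2 -> delta / 2 <= h s.

Let box_sub u v : c - delta / 2 <= u -> v <= c + delta / 2 ->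
  box u v (delta / 2) `<=` Om.
Proof.
move=> cu vc x [/andP[ux xv] xt]; apply: lt_le_trans xt _; apply: h_bulb.
by rewrite ler_distl; lra.
Qed.

(** Over the abscissas between [c + delta / 4] and [c + delta / 2], the heights
    lying between 1 and 3, the slope takes values between [delta / 12] and
    [delta / 2]. *)
Lemma tube_integral_gt0 g (C m : R) : continuous g ->
  (forall w, 0 <= g w <= C) -> 0 < m ->
  (forall w, delta / 12 <= w <= delta / 2 -> m <= g w) ->
  0 < \int[lam]_(x in Om) (g (slope c x) * dvol x).
Proof.
move=> cg gC m0 gm; have d2 : 0 < delta / 2 by rewrite divr_gt0.
pose E : set V := box (c + delta / 4) (c + delta / 2) (delta / 2).
have mE : measurable E by exact: measurable_box.
have EOm : E `<=` Om by apply: box_sub; lra.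
pose q := m * 3^-1 ^+ n.+2.
have q0 : 0 < q by rewrite mulr_gt0// exprn_gt0// invr_gt0.
apply: (@lt_le_trans _ _ (\int[lam]_(x in Om) (q * \1_E x))).
  rewrite Rintegral_indic// mulr_gt0//.
  rewrite (setIidl EOm) lebesgue_box//; last lra.
  by rewrite /= mulr_gt0 ?exprn_gt0 ?mulr_gt0//; lra.
apply: le_Rintegral => //; first exact: integrable_indic.
  apply: (integrable_slope _ (C := C)) => // w; have /andP[g0 ?] := gC w.
  by rewrite ger0_norm.
move=> x tx; have /andP[d0 d1] := dvol_bounds tx.
have /andP[x1 x3] := tube_height h_le1 tx.
have /andP[gx0 _] := gC (slope c x).
have dv0 : 0 <= dvol x by apply: le_trans d0; rewrite exprn_ge0// invr_ge0.
rewrite indicE; have [/set_mem[/andP[xl xr] _]|_] := boolP (x \in E); last first.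
  by rewrite mulr0 mulr_ge0.
rewrite mulr1 ler_pM ?exprn_ge0 ?invr_ge0 ?(ltW m0)//; apply: gm.
have t0 : 0 < x ord0 ord_max by exact: lt_trans x1.
by rewrite /slope ler_pdivlMr// ler_pdivrMr//; apply/andP; split; nra.
Qed.

(** The bulb contains a cube of side [delta], where [g] is at most [- kappa] and
    the volume density at least [3 ^ - (n + 2)]. The integrand can only be
    positive at points whose slope exceeds [delta] and is less than 1 in
    absolute value; as the height is between 1 and 3, such points lie in the
    necks at distance at most 3 from the center, hence in a box of volume
    [6 * (2 * eps) ^ (n + 1)]. The last hypothesis compares the two. *)
Lemma tube_integral_le0 g (K kappa eps : R) : continuous g ->
  (forall w, `|g w| <= K) -> 0 < kappa -> 0 < eps ->
  (forall w, `|w| <= delta -> g w <= - kappa) ->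
  (forall w, 1 <= `|w| -> g w = 0) ->
  (forall s, delta <= `|s - c| -> `|s - c| <= 3 -> h s <= eps) ->
  K * (6 * (2 * eps) ^+ n.+1) <= kappa * 3^-1 ^+ n.+2 * delta ^+ n.+2 ->
  \int[lam]_(x in Om) (g (slope c x) * dvol x) <= 0.
Proof.
move=> cg gK k0 e0 gneg gout neck small.
have K0 : 0 <= K by exact: le_trans (normr_ge0 _) (gK 0).
have d2 : 0 < delta / 2 by rewrite divr_gt0.
pose E : set V := box (c - delta / 2) (c + delta / 2) (delta / 2).
pose F : set V := box (c - 3) (c + 3) eps.
have mE : measurable E by exact: measurable_box.
have mF : measurable F by exact: measurable_box.
have EOm : E `<=` Om by exact: box_sub.
pose q := kappa * 3^-1 ^+ n.+2.
have q0 : 0 <= q by rewrite mulr_ge0 ?exprn_ge0 ?invr_ge0// ltW.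
apply: (@le_trans _ _ (\int[lam]_(x in Om) (K * \1_F x - q * \1_E x))); last first.
  rewrite RintegralB//; [|exact: integrable_indic..].
  have lamE : fine (lam E) = delta ^+ n.+2.
    rewrite lebesgue_box//; last lra.
    have -> : c + delta / 2 - (c - delta / 2) = delta by field.
    have -> : 2 * (delta / 2) = delta by field.
    by rewrite -exprS.
  have lamF : lam F = (6 * (2 * eps) ^+ n.+1)%:E.
    by rewrite lebesgue_box//; [congr (_ * _)%:E; ring|lra].
  have leF : fine (lam (F `&` Om)) <= 6 * (2 * eps) ^+ n.+1.
    have : (lam (F `&` Om) <= lam F)%E.
      by apply: le_measure; rewrite ?inE//; exact: measurableI.
    rewrite lamF; case: (lam (F `&` Om)) => [r| |]//; rewrite ?lee_fin// => _.
    by rewrite mulr_ge0// exprn_ge0// mulr_ge0// ltW.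
  rewrite (Rintegral_indic K mF) (Rintegral_indic q mE) subr_le0 (setIidl EOm).
  apply: le_trans (ler_wpM2l K0 leF) _; apply: le_trans small _.
  by rewrite lamE.
apply: le_Rintegral => //; first exact: (integrable_slope _ cg gK).
  exact: (integrableB mOm (integrable_indic K mF) (integrable_indic q mE)).
move=> x tx; have /andP[d0 d1] := dvol_bounds tx.
have /andP[x1 x3] := tube_height h_le1 tx.
have t0 : 0 < x ord0 ord_max by exact: lt_trans x1.
have dv0 : 0 <= dvol x by apply: le_trans d0; rewrite exprn_ge0// invr_ge0.
have KF0 : 0 <= K * \1_F x by rewrite mulr_ge0.
have dist : `|x ord0 ord0 - c| = `|slope c x| * x ord0 ord_max.
  by rewrite /slope normrM normfV (gtr0_norm t0) divfK// gt_eqF.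
have [wd|dw] := leP `|slope c x| delta.
  have gk := gneg _ wd.
  have : g (slope c x) * dvol x <= - q * \1_E x.
    rewrite indicE; case: (_ \in _); last by rewrite mulr0 mulr_le0_ge0//; lra.
    by rewrite mulr1 /q; nra.
  by lra.
have xE : x \notin E.
  apply/negP => /set_mem[/andP[xl xr] _].
  suff : `|slope c x| * x ord0 ord_max <= delta / 2 by nra.
  by rewrite -dist ler_distl; lra.
rewrite [\1_E x]indicE (negbTE xE) mulr0 subr0.
have [w1|w1] := leP 1 `|slope c x|; first by rewrite gout// mul0r.
have xF : x \in F.
  rewrite inE; have xc3 : `|x ord0 ord0 - c| <= 3 by rewrite dist; nra.
  split; first by move: xc3; rewrite ler_distl.
  apply: lt_le_trans tx _; apply: neck => //.
  by rewrite dist; nra.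
rewrite indicE xF mulr1; apply: le_trans (ler_norm _) _; rewrite normrM.
by rewrite (ger0_norm dv0) -[leRHS]mulr1 ler_pM.
Qed.

End bulb.

End tube_integrals.

(** * Test functions with disjoint supports *)

Lemma near_all (T : topologicalType) (x : T) (P : T -> Prop) :
  (forall y, P y) -> \forall y \near x, P y.
Proof. by move=> h; exact: filterS (fun y _ => h y) filterT. Qed.

Section compact_support.
Context {R : realType}.

Lemma bounded_of_compact_support (g : R -> R) : continuous g ->
  (forall w, 1 <= `|w| -> g w = 0) -> exists C, forall w, `|g w| <= C.
Proof.
move=> cg g0; have [|c _ cmax] := @EVT_max R (fun w => `|g w|) (-1) 1 ltac:(lra).
  by apply: continuous_subspaceT => w; apply: cvg_norm; exact: cg.
exists `|g c| => w; have [w1|w1] := leP 1 `|w|.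
  by rewrite g0// normr0.
by apply: cmax; rewrite in_itv /= -ler_norml ltW.
Qed.

Lemma Rintegral_sum d (T : measurableType d) (mu : {measure set T -> \bar R})
    (D : set T) (I : finType) (F : I -> T -> R) : measurable D ->
  (forall i, mu.-integrable D (EFin \o F i)) ->
  \int[mu]_(x in D) (\sum_i F i x) = \sum_i \int[mu]_(x in D) F i x.
Proof.
move=> mD iF.
suff [] : mu.-integrable D (EFin \o (fun x => \sum_(i <- index_enum I) F i x)) /\
    \int[mu]_(x in D) (\sum_(i <- index_enum I) F i x) =
    \sum_(i <- index_enum I) \int[mu]_(x in D) F i x by [].
elim: (index_enum I) => [|i s [IHi IHe]].
  under eq_fun do rewrite big_nil.
  split; first exact: integrable0.
  by rewrite big_nil Rintegral_cst// mul0r.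
under eq_fun do rewrite big_cons.
split; first exact: (integrableD mD (iF i) IHi).
by rewrite big_cons -IHe -RintegralD.
Qed.

End compact_support.

Section densities.
Context {R : realType}.
Variable n : nat.
Implicit Types w : R.

(** The densities along [profile \o slope a] of the energy and of the squared
    norm of [H^2] as functions of the slope, in dimension [n + 2]. *)
Definition energy_profile w : R :=
  (profile2 w * (1 + w ^+ 2) + profile1 w * w) ^+ 2 - n.+1%:R * profile1 w ^+ 2.

Definition H2_profile w : R :=
  (profile2 w * (1 + w ^+ 2) + profile1 w * w) ^+ 2
  + n.+1%:R * (profile1 w * w) ^+ 2 + profile1 w ^+ 2 * (1 + w ^+ 2)
  + profile w ^+ 2.

Let cvg_sqr (f : R -> R) w : f x @[x --> w] --> f w ->
  f x ^+ 2 @[x --> w] --> f w ^+ 2.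
Proof. by move=> cf; rewrite expr2; under eq_fun do rewrite expr2; exact: cvgM. Qed.

Let cvg_square w : (1 + x ^+ 2) @[x --> w] --> 1 + w ^+ 2.
Proof. by apply: cvgD; [exact: cvg_cst|apply: cvg_sqr; exact: cvg_id]. Qed.

Let cvg_hessian_part w :
  (profile2 x * (1 + x ^+ 2) + profile1 x * x) ^+ 2 @[x --> w] -->
  (profile2 w * (1 + w ^+ 2) + profile1 w * w) ^+ 2.
Proof.
apply: cvg_sqr; apply: cvgD; apply: cvgM.
- exact: continuous_profile2.
- exact: cvg_square.
- exact: continuous_profile1.
- exact: cvg_id.
Qed.

Lemma continuous_profile_sqr : continuous (fun w : R => profile w ^+ 2).
Proof. by move=> w; apply: cvg_sqr; exact: continuous_profile. Qed.

Lemma continuous_energy_profile : continuous energy_profile.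
Proof.
move=> w; apply: cvgB; first exact: cvg_hessian_part.
apply: cvgM; first exact: cvg_cst.
by apply: cvg_sqr; exact: continuous_profile1.
Qed.

Lemma continuous_H2_profile : continuous H2_profile.
Proof.
move=> w; apply: cvgD; last exact: continuous_profile_sqr.
apply: cvgD; last first.
  by apply: cvgM; [apply: cvg_sqr; exact: continuous_profile1|exact: cvg_square].
apply: cvgD; first exact: cvg_hessian_part.
apply: cvgM; first exact: cvg_cst.
by apply: cvg_sqr; apply: cvgM; [exact: continuous_profile1|exact: cvg_id].
Qed.

Lemma energy_profile_out w : 1 <= `|w| -> energy_profile w = 0.
Proof.
move=> /profile_out[_ f1 f2]; rewrite /energy_profile f1 f2.
by rewrite !mul0r addr0 expr0n /= mulr0 subrr.
Qed.

Lemma H2_profile_out w : 1 <= `|w| -> H2_profile w = 0.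
Proof.
move=> /profile_out[f0 f1 f2]; rewrite /H2_profile f0 f1 f2.
by rewrite !mul0r addr0 expr0n /= mulr0 mul0r !addr0.
Qed.

Lemma profile_sqr_out w : 1 <= `|w| -> profile w ^+ 2 = 0.
Proof. by move=> /profile_out[-> _ _]; rewrite expr0n. Qed.

Lemma profile_le_H2_profile w : profile w ^+ 2 <= H2_profile w.
Proof.
rewrite lerDr; apply: addr_ge0; [apply: addr_ge0|apply: mulr_ge0].
- exact: sqr_ge0.
- by apply: mulr_ge0 => //; exact: sqr_ge0.
- exact: sqr_ge0.
- by apply: addr_ge0 => //; exact: sqr_ge0.
Qed.

End densities.

Section bumps.
Context {R : realType} {n : nat}.
Local Notation V := 'rV[R]_n.+2.
Local Notation lam := (@lebesgue_rV R n.+2).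
Local Notation dvol := (vol_density hyp_metric).
Variable h : R -> R.
Hypothesis h_lip : forall s t, `|h s - h t| <= `|s - t|.
Hypothesis h_le1 : forall s, h s <= 1.
Variables A B : R.
Hypothesis AB : A < B.
Hypothesis h_supp : forall s, 0 < h s -> A < s < B.
Local Notation Om := (tube h : set V).
Implicit Types (x : V) (c w : R) (g : R -> R).

Definition bump c x : R := profile (slope c x).

Lemma elementary_bump c : elementary (bump c).
Proof.
have es : elementary (slope c : V -> R).
  apply: (elementaryM (u := fun x => x ord0 ord0 + - c)).
    by apply: elementaryD; [exact: elementary_coord|exact: elementary_cst].
  exact: elementary_Vheight.
have -> : bump c = fun x : V =>
    slope c x * flat 0 (1 + -1 * (slope c x * slope c x)).
  by apply/funext => x; rewrite /bump /profile mulN1r expr2.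
apply: elementaryM => //; apply: elementary_flat; apply: elementaryD.
  exact: elementary_cst.
by apply: elementaryM; [exact: elementary_cst|exact: elementaryM].
Qed.

Variables (j : nat) (ctr : 'I_j -> R).
Hypothesis j_gt0 : (0 < j)%N.
Hypothesis sep : forall i k, i != k -> 8 <= `|ctr i - ctr k|.
Implicit Types (a : 'rV[R]_j) (i k : 'I_j).

Definition bumps a x : R := \sum_i a ord0 i * bump (ctr i) x.

(** As the slopes are measured at heights below 3 and the centers are at least
    8 apart, near every point at most one bump is active. *)
Lemma bumps_local a x : Om x -> exists i,
  (forall k, k != i -> 1 <= `|slope (ctr k) x|) /\
  \forall y \near x, bumps a y = a ord0 i * profile (slope (ctr i) y).
Proof.
move=> tx; have /andP[x1 x3] := tube_height h_le1 tx.
have t0 : 0 < x ord0 ord_max by exact: lt_trans x1.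
have [i hi] : exists i, forall k, k != i -> 3 < `|x ord0 ord0 - ctr k|.
  have [[i xi]|no] := pselect (exists i, `|x ord0 ord0 - ctr i| <= 3).
    exists i => k ki; have := sep ki; have := ler_distD (x ord0 ord0) (ctr k) (ctr i).
    by rewrite (distrC (ctr k) (x ord0 ord0)); lra.
  exists (Ordinal j_gt0) => k _; rewrite ltNge; apply/negP => xk.
  by apply: no; exists k.
have slope_gt1 k : k != i -> 1 < `|slope (ctr k) x|.
  move=> /hi ki; rewrite /slope normrM normfV (gtr0_norm t0).
  by rewrite ltr_pdivlMr// mul1r (lt_trans x3).
exists i; split=> [k /slope_gt1/ltW//|].
have near1 k : \forall y \near x, k != i -> 1 <= `|slope (ctr k) y|.
  have [->|ki] := eqVneq k i; first by apply: near_all => y; rewrite ?eqxx.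
  have cs : `|slope (ctr k) y| @[y --> x] --> `|slope (ctr k) x|.
    have ds := differentiable_slope (ctr k) (tube_half_space h_le1 tx).
    exact: cvg_norm (differentiable_continuous ds).
  have near_gt : \forall y \near x, 1 < `|slope (ctr k) y|.
    by apply: cvgr_gt cs _ _; exact: slope_gt1.
  exact: filterS (fun y h _ => ltW h) near_gt.
have fx : Filter (nbhs x) by exact: nbhs_filter.
have near_all1 := filter_forall fx near1.
apply: filterS near_all1 => y hy; rewrite /bumps (bigD1 i)//= big1 ?addr0// => k ki.
by have [f0 _ _] := profile_out (hy _ ki); rewrite /bump f0 mulr0.
Qed.

Let sum_active a x g i : (forall w, 1 <= `|w| -> g w = 0) ->
  (forall k, k != i -> 1 <= `|slope (ctr k) x|) ->
  \sum_k a ord0 k ^+ 2 * g (slope (ctr k) x) =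
  a ord0 i ^+ 2 * g (slope (ctr i) x).
Proof.
move=> g0 hk; rewrite (bigD1 i)//= big1 ?addr0// => k ki.
by rewrite g0 ?mulr0// hk.
Qed.

Let dprofile (b w : R) : is_derive w (1 : R) (fun w => b * profile w) (b * profile1 w).
Proof. by have := is_deriveZ b (is_derive_profile w). Qed.

Let dprofile1 (b w : R) : is_derive w (1 : R) (fun w => b * profile1 w) (b * profile2 w).
Proof. by have := is_deriveZ b (is_derive_profile1 w). Qed.

Lemma energy_density_bumps a x : Om x ->
  tensor_dot hyp_metric x (hessian hyp_metric (bumps a) x)
    (hessian hyp_metric (bumps a) x)
  + Defs.form (ricci hyp_metric x) (gradient hyp_metric (bumps a) x)
      (gradient hyp_metric (bumps a) x) =
  \sum_k a ord0 k ^+ 2 * energy_profile n (slope (ctr k) x).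
Proof.
move=> tx; have [i [hi ui]] := bumps_local a tx.
rewrite (sum_active _ (@energy_profile_out R n) hi).
rewrite (energy_density_comp_slope (dprofile _) (dprofile1 _)
  (tube_half_space h_le1 tx) ui).
by rewrite /energy_profile; ring.
Qed.

Lemma H2_density_bumps a x : Om x -> H2_density hyp_metric (bumps a) x =
  \sum_k a ord0 k ^+ 2 * H2_profile n (slope (ctr k) x).
Proof.
move=> tx; have [i [hi ui]] := bumps_local a tx.
rewrite (sum_active _ (@H2_profile_out R n) hi).
rewrite (H2_density_comp_slope (dprofile _) (dprofile1 _)
  (tube_half_space h_le1 tx) ui).
by rewrite /H2_profile; ring.
Qed.

Lemma sqr_bumps a x : Om x ->
  bumps a x ^+ 2 = \sum_k a ord0 k ^+ 2 * profile (slope (ctr k) x) ^+ 2.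
Proof.
move=> tx; have [i [hi ui]] := bumps_local a tx.
rewrite (sum_active (g := fun w => profile w ^+ 2) _ (@profile_sqr_out R) hi).
by rewrite (nbhs_singleton ui) exprMn.
Qed.

Definition slope_integral g c : R := \int[lam]_(x in Om) (g (slope c x) * dvol x).

Let mOm : measurable Om.
Proof.
apply: measurable_tube.
by apply: (@continuous_of_lipschitz _ _ _ h 1) => s t; rewrite mul1r.
Qed.

Let integrable_density g c : continuous g -> (forall w, 1 <= `|w| -> g w = 0) ->
  lam.-integrable Om (EFin \o (fun x => g (slope c x) * dvol x)).
Proof.
move=> cg g0; have [C gC] := bounded_of_compact_support cg g0.
exact: (integrable_slope h_lip h_le1 AB h_supp c cg gC).
Qed.

Let integrable_profile_sqr c := integrable_density c
  (@continuous_profile_sqr R) (@profile_sqr_out R).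

Let vintegral_bumps a (u : V -> R) g : continuous g ->
  (forall w, 1 <= `|w| -> g w = 0) ->
  (forall x, Om x -> u x = \sum_k a ord0 k ^+ 2 * g (slope (ctr k) x)) ->
  vintegral hyp_metric Om u = \sum_k a ord0 k ^+ 2 * slope_integral g (ctr k).
Proof.
move=> cg g0 uE.
rewrite /vintegral; transitivity (\int[lam]_(x in Om)
    (\sum_k a ord0 k ^+ 2 * (g (slope (ctr k) x) * dvol x))).
  apply: eq_Rintegral => x /[!inE] /uE ->; rewrite mulr_suml.
  by apply: eq_bigr => k _; rewrite mulrA.
rewrite Rintegral_sum//; last first.
  move=> k; have ig := integrable_density (ctr k) cg g0.
  exact: (integrableZl mOm (a ord0 k ^+ 2) ig).
by apply: eq_bigr => k _; rewrite RintegralZl//; exact: integrable_density.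
Qed.

Lemma energy_bumps a : energy_smooth hyp_metric Om (bumps a) =
  \sum_k a ord0 k ^+ 2 * slope_integral (energy_profile n) (ctr k).
Proof.
apply: vintegral_bumps => [||x /energy_density_bumps ->//].
  exact: continuous_energy_profile.
exact: energy_profile_out.
Qed.

Lemma L2_bumps a : vintegral hyp_metric Om (fun x => bumps a x ^+ 2) =
  \sum_k a ord0 k ^+ 2 * slope_integral (fun w => profile w ^+ 2) (ctr k).
Proof.
apply: vintegral_bumps => [||x /sqr_bumps//]; first exact: continuous_profile_sqr.
exact: profile_sqr_out.
Qed.

Lemma H2_norm_bumps a : H2_norm hyp_metric Om (bumps a) =
  Num.sqrt (\sum_k a ord0 k ^+ 2 * slope_integral (H2_profile n) (ctr k)).
Proof.
rewrite /H2_norm; congr Num.sqrt; apply: vintegral_bumps => [||x /H2_density_bumps//].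
  exact: continuous_H2_profile.
exact: H2_profile_out.
Qed.

Lemma H2_smooth_bump c : H2_smooth hyp_metric Om (bump c).
Proof.
split.
  exact: elementary_smooth_on (tube_half_space h_le1) (elementary_bump c).
have := integrable_lty mOm (integrable_density c (@continuous_H2_profile R n)
  (@H2_profile_out R n)).
congr (_ < _)%E; apply: eq_integral => x /[!inE] tx /=.
have ui : \forall y \near x, bump c y = profile (slope c y) by exact: near_all.
by rewrite (H2_density_comp_slope (is_derive_profile (R := R))
  (is_derive_profile1 (R := R)) (tube_half_space h_le1 tx) ui).
Qed.

Lemma H2_norm0 : H2_norm hyp_metric Om (fun=> 0) = 0.
Proof.
rewrite /H2_norm /vintegral (@eq_Rintegral _ _ _ lam Om (fun=> 0)) => [|x /[!inE] tx].
  by rewrite Rintegral_cst// mul0r sqrtr0.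
have d0 (w : R) : is_derive w (1 : R) (fun=> 0 : R) 0 by exact: is_derive_cst.
have ui : \forall y \near x, (0 : R) = (fun=> 0) (slope 0 y) by exact: near_all.
rewrite (@H2_density_comp_slope R n (fun=> 0) (fun=> 0) (fun=> 0) d0 d0 0 (fun=> 0)
  x (tube_half_space h_le1 tx) ui).
by ring.
Qed.

Hypothesis L2_gt0 : forall k, 0 < slope_integral (fun w => profile w ^+ 2) (ctr k).

Let L2_bumps_gt0 a : a != 0 ->
  0 < vintegral hyp_metric Om (fun x => bumps a x ^+ 2).
Proof.
move=> a0; rewrite L2_bumps lt_neqAle; apply/andP; split; last first.
  by apply: sumr_ge0 => k _; rewrite mulr_ge0 ?sqr_ge0// ltW.
apply: contraNneq a0 => /esym/eqP; rewrite psumr_eq0 => [/allP h0|k _]; last first.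
  by rewrite mulr_ge0 ?sqr_ge0// ltW.
apply/eqP/rowP => k; have := h0 k (mem_index_enum _).
by rewrite mulf_eq0 sqrf_eq0 (gt_eqF (L2_gt0 k)) orbF mxE => /eqP.
Qed.

Let basis (k : 'I_j) : nat -> V -> R := fun _ => bump (ctr k).

Let limn_lincomb (E : (V -> R) -> R) a :
  limn (fun m => E (lincomb a basis m)) = E (bumps a).
Proof. exact: (@lim_cst _ (@Rhausdorff R) nat \oo _ (E (bumps a))). Qed.

(** The bumps are smooth, so that each is represented by a constant Cauchy
   sequence. Their independence follows from that of their images in L^2. *)
Let H2_free_basis : H2_free hyp_metric Om basis.
Proof.
split=> [k|a].
  split=> [m|e e0]; first exact: H2_smooth_bump.
  exists 0%N => p q _ _; rewrite (_ : _ \- _ = fun=> 0) ?H2_norm0//.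
  by apply/funext => x; rewrite /= subrr.
move=> hn; apply/eqP; apply: contraPT hn => a0 /(cvg_lim (@Rhausdorff R)).
rewrite (limn_lincomb (H2_norm hyp_metric Om)).
apply/eqP; rewrite gt_eqF// H2_norm_bumps sqrtr_gt0.
apply: lt_le_trans (L2_bumps_gt0 a0) _; rewrite L2_bumps.
apply: ler_sum => k _; apply: ler_wpM2l; first exact: sqr_ge0.
apply: le_Rintegral => //.
- exact: integrable_density (@continuous_H2_profile R n) (@H2_profile_out R n).
- move=> x tx; apply: ler_wpM2r; last exact: profile_le_H2_profile.
  by rewrite vol_density_hyp_metric ?invr_ge0 ?exprn_ge0 ?ltW//;
     exact: (tube_half_space h_le1 tx).
Qed.

(** Since the supports are disjoint, the energy and the norm of L^2 are both
    diagonal on the span of the bumps, and it is enough to compare their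
    diagonal coefficients. *)
Lemma neumann_eigenvalue_le (M : R) :
  (forall k, slope_integral (fun w => energy_profile n w + M * profile w ^+ 2)
     (ctr k) <= 0) ->
  (neumann_eigenvalue hyp_metric Om j <= (- M)%:E)%E.
Proof.
move=> EM.
apply: (@le_trans _ _ (ereal_sup [set (rayleigh hyp_metric Om (lincomb c basis))%:E |
    c in [set c : 'rV[R]_j | c != 0]])).
  by apply: ereal_inf_lbound; exists basis.
apply: ge_ereal_sup => _ [a /= a0 <-]; rewrite lee_fin.
have -> : rayleigh hyp_metric Om (lincomb a basis) =
    energy_smooth hyp_metric Om (bumps a) /
    vintegral hyp_metric Om (fun x => bumps a x ^+ 2).
  congr (_ / _); first exact: limn_lincomb.
  exact: (limn_lincomb (fun u => vintegral hyp_metric Om (fun x => u x ^+ 2))).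
rewrite ler_pdivrMr ?L2_bumps_gt0// -subr_le0 mulNr opprK.
rewrite energy_bumps L2_bumps mulr_sumr -big_split /=.
apply: sumr_le0 => k _; rewrite mulrCA -mulrDr.
apply: mulr_ge0_le0; first exact: sqr_ge0.
apply: le_trans (EM k).
have iE := integrable_density (ctr k) (@continuous_energy_profile R n)
  (@energy_profile_out R n).
have iL := integrable_profile_sqr (ctr k).
rewrite /slope_integral -RintegralZl// -RintegralD//; last first.
  exact: (integrableZl mOm M iL).
rewrite le_eqVlt; apply/orP; left; apply/eqP; apply: eq_Rintegral => x _.
by ring.
Qed.

End bumps.

(** * The domain *)

Section parameters.
Context {R : realType}.
Variables (n : nat) (M : R).

Definition shifted_energy (w : R) : R := energy_profile n w + M * profile w ^+ 2.

Lemma continuous_shifted_energy : continuous shifted_energy.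
Proof.
move=> w; apply: cvgD; first exact: continuous_energy_profile.
by apply: cvgM; [exact: cvg_cst|exact: continuous_profile_sqr].
Qed.

Lemma shifted_energy_out w : 1 <= `|w| -> shifted_energy w = 0.
Proof.
move=> w1; rewrite /shifted_energy energy_profile_out// profile_sqr_out//.
by rewrite mulr0 addr0.
Qed.

(** Since [profile] and [profile2] vanish at 0, only the Ricci term is left. *)
Lemma shifted_energy0_lt0 : shifted_energy 0 < 0.
Proof.
rewrite /shifted_energy /energy_profile profile0 profile20 !(mul0r, mulr0) addr0.
rewrite expr0n /= mulr0 addr0 sub0r oppr_lt0 mulr_gt0// exprn_even_gt0//=.
exact: profile10.
Qed.

Lemma shifted_energy_near0 : exists kappa d : R, [/\ 0 < kappa, 0 < d &
  forall w, `|w| <= d -> shifted_energy w <= - kappa].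
Proof.
have : \forall w \near 0, shifted_energy w < shifted_energy 0 / 2.
  apply: cvgr_lt (continuous_shifted_energy (x := 0)) _ _.
  by have := shifted_energy0_lt0; lra.
move=> /nbhs_ballP[e /= e0 he]; exists (- (shifted_energy 0 / 2)), (e / 2).
split; [by have := shifted_energy0_lt0; lra|lra|move=> w we].
rewrite opprK; apply: ltW; apply: he.
by rewrite /ball /= sub0r normrN; lra.
Qed.

Lemma profile_sqr_lower_bound (d : R) : 0 < d -> d <= 1 -> exists2 m : R, 0 < m &
  forall w, d / 12 <= w <= d / 2 -> m <= profile w ^+ 2.
Proof.
move=> d0 d1.
have [|c + cmin] := @EVT_min R (fun w => profile w ^+ 2) (d / 12) (d / 2) ltac:(lra).
  exact: continuous_subspaceT continuous_profile_sqr.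
rewrite in_itv /= => /andP[c1 c2].
exists (profile c ^+ 2); last by move=> w wd; apply: cmin; rewrite in_itv.
by rewrite exprn_even_gt0//= profile_neq0//; lra.
Qed.

(** The contribution of the necks tends to 0 with [eps]. *)
Lemma exists_thin_neck (K b : R) : 0 <= K -> 0 < b -> exists eps : R,
  [/\ 0 < eps, eps <= b & K * (6 * (2 * eps) ^+ n.+1) <= b].
Proof.
move=> K0 b0; have K1 : 0 < 12 * K + 1 by lra.
pose e := Num.min (2^-1) (Num.min b (b / (12 * K + 1))).
have e0 : 0 < e by rewrite /e !lt_min invr_gt0 ltr0n b0 divr_gt0.
have e2 : e <= 2^-1 by rewrite /e ge_min lexx.
have eb : e <= b by rewrite /e !ge_min lexx !orbT.
have eK : e * (12 * K + 1) <= b.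
  by rewrite -ler_pdivlMr// /e !ge_min lexx !orbT.
exists e; split => //.
have p1 : (2 * e) ^+ n <= 1 by apply: exprn_ile1; lra.
have p2 : (2 * e) ^+ n.+1 <= 2 * e.
  by rewrite exprS ler_piMr//; lra.
have : K * (6 * (2 * e) ^+ n.+1) <= K * (6 * (2 * e)).
  by rewrite ler_wpM2l// ler_wpM2l.
by lra.
Qed.

End parameters.

Theorem theorem4p8 (R : realType) (n : nat) (hn : (2 <= n.+1)%N)
    (N : nat) (hN : (0 < N)%N) (M : R) (hM : 0 < M) :
  exists Omega : set 'rV[R]_n.+1,
    [/\ hyp_domain Omega,
        hyp_bounded Omega,
        lipschitz_boundary Omega,
        volume hyp_metric Omega = 1%E &
        forall j : nat, (1 <= j <= N)%N ->
          (neumann_eigenvalue hyp_metric Omega j <= (- M)%:E)%E].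
Proof.
case: n hn => // n _.
(* [kappa] and [d] bound the shifted energy near 0, [K] bounds it everywhere *)
have [kappa [d [kappa0 d0 gd]]] := @shifted_energy_near0 R n M.
have [K gK] := bounded_of_compact_support (@continuous_shifted_energy R n M)
  (@shifted_energy_out R n M).
have K0 : 0 <= K by exact: le_trans (normr_ge0 _) (gK 0).
(* [r] is so small that the tube without its cylinder has volume less than 1 *)
pose b : R := 8 * N.+1%:R + 2.
have b2 : 2 < b by rewrite /b ltrDr mulr_gt0.
pose r := (4 * b)^-1.
have r0 : 0 < r by rewrite invr_gt0; lra.
have br : b * (2 * r) < 1.
  have : r * (4 * b) = 1 by rewrite mulVf// gt_eqF//; lra.
  by lra.
have r1 : r <= 1 by nra.
pose delta := Num.min d r.
have delta0 : 0 < delta by rewrite lt_min d0.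
have delta_d : delta <= d by rewrite ge_min lexx.
have delta_r : delta <= r by rewrite ge_min lexx orbT.
pose q := Num.min delta (kappa * 3^-1 ^+ n.+2 * delta ^+ n.+2).
have q0 : 0 < q.
  rewrite /q lt_min delta0 /=; apply: mulr_gt0; last exact: exprn_gt0.
  by apply: mulr_gt0 => //; apply: exprn_gt0; rewrite invr_gt0 ltr0n.
have [eps [eps0 epsq small]] := exists_thin_neck n K0 q0.
have eps_delta : eps <= delta by move: epsq; rewrite le_min => /andP[].
have {}small : K * (6 * (2 * eps) ^+ n.+1) <= kappa * 3^-1 ^+ n.+2 * delta ^+ n.+2.
  by move: small; rewrite le_min => /andP[].
have [L L0 volL] := @exists_unit_volume R n N delta eps r eps0 eps_delta delta_r br.
pose h := radius N delta eps r L; pose A : R := left_end N; pose B := 2 * r + L.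
have h_lip s t : `|h s - h t| <= `|s - t| by exact: radius_lip.
have h_le1 s : h s <= 1 by apply: le_trans r1; exact: radius_le.
have h_gt0 s : 0 < h s <-> A < s < B by exact: radius_gt0.
have h_supp s : 0 < h s -> A < s < B by move=> /h_gt0.
have AB : A < B.
  have : 0 < 8 * N.+1%:R :> R by rewrite mulr_gt0.
  by rewrite /A /B /left_end; lra.
exists (tube h); split=> //.
- split.
  + exact: tube_half_space.
  + exact: open_tube.
  + exact: (connected_tube h_gt0).
  + exists (cons_rV ((A + B) / 2, const_mx 2)).
    rewrite /tube /= tail_cons subrr normr0 cons_rV0 /=; apply/h_gt0; lra.
- exact: (hyp_bounded_tube h_le1 h_gt0).
- apply: lipschitz_boundary_tube => // s hs; exact: radius_tip.
move=> j /andP[j0 jN].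
pose ctr (i : 'I_j) : R := center (widen_ord jN i).
have bulb (i : 'I_j) s : `|s - ctr i| <= delta / 2 -> delta / 2 <= h s.
  exact: radius_bulb.
have [m m0 fm] := profile_sqr_lower_bound delta0 (le_trans delta_r r1).
have [C fC] := bounded_of_compact_support (@continuous_profile_sqr R)
  (@profile_sqr_out R).
apply: (@neumann_eigenvalue_le R n h h_lip h_le1 A B AB h_supp j ctr) => //.
- by move=> i k ik; apply: (@center_dist R N).
- move=> i; apply: (@tube_integral_gt0 R n h h_lip h_le1 A B AB h_supp (ctr i)
    delta delta0 (bulb i) _ C m) => // [w|w].
    exact: continuous_profile_sqr.
  by rewrite sqr_ge0 (le_trans (ler_norm _) (fC w)).
- move=> i; apply: (@tube_integral_le0 R n h h_lip h_le1 A B AB h_supp (ctr i)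
    delta delta0 (bulb i) (@shifted_energy R n M) K kappa eps) => //.
  + exact: continuous_shifted_energy.
  + by move=> w wd; apply: gd; exact: le_trans wd delta_d.
  + exact: shifted_energy_out.
  + by move=> s; exact: radius_neck.
Qed.
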